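(* For every positive integer $n$ and every coloring of the edges of the complete graph $K_n$ with two colors (red and blue), there is a collection of at most $\lceil\sqrt n\,\rceil$ monochromatic cycles, all of the same color, whose vertex sets together cover all vertices of $K_n$.
   Context: A single vertex and a single edge (with its two endpoints) are regarded as (degenerate) cycles. A single vertex counts as a monochromatic cycle of either color; a single edge counts as a monochromatic cycle of its own color. A non-degenerate cycle (on at least $3$ vertices) is monochromatic of a given color if all its edges have that color. The cycles in a cover are allowed to intersect. *)

(* Defs.v *)
From mathcomp Require Import all_boot all_order all_algebra.
From mathcomp Require Import reals.

Set Implicit Arguments.
Unset Strict Implicit.
Unset Printing Implicit Defensive.

(* The vertices of K_n are the elements of 'I_n.  A colouring of its edges by
   red (true) and blue (false) is a symmetric c : rel 'I_n, where c x y is the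
   colour of the edge xy for x != y; monochromatic_cycle c does not depend on
   the diagonal values c x x, which carry no meaning. *)

(* A cycle is given by the list of its distinct vertices in cyclic order; a
   single vertex and a single edge are degenerate cycles. *)
Definition monochromatic_cycle (T : eqType) (c : rel T) (b : bool)
    (s : seq T) : bool :=
  match s with
  | [::] => false
  | [:: _] => true
  | [:: x; y] => (x != y) && (c x y == b)
  | _ => ucycleb [rel x y | c x y == b] s
  end.

(* Main.v *)
(* Let n <= k^2 and suppose that neither colour has a cover by k cycles.  By
   Posa's theorem (a graph is covered by at most alpha cycles) each colour has a
   monochromatic clique, the hub, with more than k vertices.  Kouider's theorem,
   in a version where the vertices only need to be highly connected to the hub,
   covers a set of stability number at most N kap by N cycles; hence in each
   colour more than k vertices can be cut off from the hub by fewer than k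
   vertices.  The other colour is complete across such a cut.  If y is cut
   off in one colour and z in the other, then z lies in the separator of y or y
   in that of z; counting these incidences over k + 1 vertices y and k + 1
   vertices z contradicts n <= k^2.  The vertices of M, which a single vertex
   cuts off, need special care: a large M forces a large hub. *)

Require Import Defs.
From mathcomp Require Import all_boot all_order all_algebra.
From mathcomp Require Import reals.
From mathcomp Require Import zify.
From Stdlib Require Import Classical.

Set Implicit Arguments.
Unset Strict Implicit.
Unset Printing Implicit Defensive.

(** * Stability number and partitions into cycles *)

(** The thresholds come from the price of a cycle. A cycle visiting vertices that fewer than [kap]
    vertices cannot cut off lowers the stability number of the rest by [kap], less one if it is
    forced through a vertex of weaker connection. A vertex of [M] cannot in general be forced onto a
    cycle through the hub, which takes two disjoint links; it is paired with its only neighbour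
    outside [M], and [k - #|M|] cycles remain. Here [kap] is the first level at which more than [k]
    vertices are cut off, and this price list bounds the total size of the [k + 1] separators by a
    stability number plus [kap + #|M|]. As a stable set meets the hub at most once, the two bounds
    leave room for [(k + 1)^2] incidences only if [M] has at least 4 vertices in each colour. But
    separators of vertices of [M] have at most one vertex, so the pairs within the two sets [M]
    allow too few incidences. The remaining obstacle is a pair of cuts without incidence: one side
    of a cut then lies inside the other separator, and this configuration is refuted by a cover of
    its own. *)

Section Stable.
Context (V : finType) (e : rel V).
Implicit Types (I J S D O : {set V}).

Definition stable I := [forall x in I, forall y in I, ~~ e x y].

Definition alpha S := \max_(I : {set V} | stable I && (I \subset S)) #|I|.

Lemma stableP I : reflect {in I &, forall x y, ~~ e x y} (stable I).
Proof.
apply: (iffP forall_inP) => [h x y xI yI|h x xI]; last first.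
  by apply/forall_inP => y yI; apply: h.
by have /forall_inP := h x xI; apply.
Qed.

Lemma stable0 : stable set0.
Proof. by apply/stableP => x y; rewrite inE. Qed.

Lemma alpha_ex S : exists2 I, stable I & I \subset S /\ #|I| = alpha S.
Proof.
rewrite /alpha (bigmax_eq_arg set0) ?stable0 ?sub0set //.
case: arg_maxnP => [|I /andP[sI IS] _]; first by rewrite stable0 sub0set.
by exists I.
Qed.

Lemma alpha_ge S I : stable I -> I \subset S -> #|I| <= alpha S.
Proof. by move=> sI IS; apply: leq_bigmax_cond; rewrite sI. Qed.

Lemma stableS I J : I \subset J -> stable J -> stable I.
Proof.
move=> /subsetP IJ /stableP sJ; apply/stableP => x y xI yI.
by apply: sJ; apply: IJ.
Qed.

Lemma alphaS S S' : S \subset S' -> alpha S <= alpha S'.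
Proof.
by move=> SS; have [I sI [IS <-]] := alpha_ex S; apply: alpha_ge (subset_trans IS SS).
Qed.

Lemma alpha_card S : alpha S <= #|S|.
Proof. by have [I sI [IS <-]] := alpha_ex S; apply: subset_leq_card. Qed.

Lemma alpha0 : alpha set0 = 0.
Proof. by apply/eqP; rewrite -leqn0 -(cards0 V) alpha_card. Qed.

Lemma alphaU S S' : alpha (S :|: S') <= alpha S + alpha S'.
Proof.
have [I sI [IS <-]] := alpha_ex (S :|: S').
have -> : I = (I :&: S) :|: (I :&: S') by rewrite -setIUr; apply/esym/setIidPl.
apply: leq_trans (leq_card_setU _ _) _.
by apply: leq_add; apply: alpha_ge; rewrite ?subsetIr //; apply: stableS sI; rewrite subsetIl.
Qed.

Lemma alphaU1 x S : alpha (x |: S) <= (alpha S).+1.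
Proof.
apply: leq_trans (alphaU _ _) _; rewrite -add1n leq_add2r.
by apply: leq_trans (alpha_card _) _; rewrite cards1.
Qed.

Hypothesis e_sym : symmetric e.
Hypothesis e_irr : irreflexive e.

Lemma stable1 x : stable [set x].
Proof. by apply/stableP => y z /set1P -> /set1P ->; rewrite e_irr. Qed.

Lemma alpha_gt0 S : (0 < alpha S) = (S != set0).
Proof.
apply/idP/set0Pn => [|[x xS]]; last first.
  by rewrite -(cards1 x); apply: alpha_ge; rewrite ?stable1 // sub1set.
by case: (set_0Vmem S) => [->|[x xS] _]; [rewrite alpha0 | exists x].
Qed.

Lemma alpha_eq0 S : (alpha S == 0) = (S == set0).
Proof. by apply: negb_inj; rewrite -lt0n alpha_gt0. Qed.

Lemma stableU1 x I :
  stable I -> (forall y, y \in I -> ~~ e x y) -> stable (x |: I).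
Proof.
move=> /stableP sI xI; apply/stableP => y z /setU1P[->|yI] /setU1P[->|zI].
- by rewrite e_irr.
- exact: xI.
- by rewrite e_sym; apply: xI.
- exact: sI.
Qed.

Lemma stableU I J : stable I -> stable J ->
  (forall x y, x \in I -> y \in J -> ~~ e x y) -> stable (I :|: J).
Proof.
move=> /stableP sI /stableP sJ IJ; apply/stableP => y z /setUP[yI|yI] /setUP[zI|zI].
- exact: sI.
- exact: IJ.
- by rewrite e_sym; apply: IJ.
- exact: sJ.
Qed.

Lemma alpha_add S S' : [disjoint S & S'] ->
  (forall x y, x \in S -> y \in S' -> ~~ e x y) ->
  alpha (S :|: S') = alpha S + alpha S'.
Proof.
move=> dSS' SS'; apply/eqP; rewrite eqn_leq alphaU /=.
have [I sI [IS <-]] := alpha_ex S; have [J sJ [JS <-]] := alpha_ex S'.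
have dIJ : [disjoint I & J] by apply: disjointW dSS'.
rewrite -cardsUI (disjoint_setI0 dIJ) cards0 addn0.
apply: alpha_ge; last exact: setUSS.
by apply: stableU => // x y xI yJ; apply: SS'; [apply: (subsetP IS) | apply: (subsetP JS)].
Qed.

(** All four stability numbers split over the two unrelated sides. In use, it says that the
    increments caused by [O1] and by [O2] add up. *)
Lemma alpha_modular D1 D2 O1 O2 :
    [disjoint D1 :|: O1 & D2 :|: O2] ->
    (forall x y, x \in D1 :|: O1 -> y \in D2 :|: O2 -> ~~ e x y) ->
  alpha ((D1 :|: O1) :|: (D2 :|: O2)) + alpha (D1 :|: D2) =
  alpha ((D1 :|: O1) :|: D2) + alpha (D1 :|: (D2 :|: O2)).
Proof.
move=> dis noe.
have sub (A B : {set V}) : A \subset D1 :|: O1 -> B \subset D2 :|: O2 ->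
    alpha (A :|: B) = alpha A + alpha B.
  move=> sA sB; apply: alpha_add; first exact: disjointW dis.
  by move=> x y xA yB; apply: noe; [apply: (subsetP sA) | apply: (subsetP sB)].
by rewrite (sub (D1 :|: O1) (D2 :|: O2)) // (sub D1 D2) ?subsetUl //
  (sub (D1 :|: O1) D2) ?subsetUl // (sub D1 (D2 :|: O2)) ?subsetUl //; lia.
Qed.

(** [cycle] asks for a loop on a one-vertex list, hence the separate clause. For symmetric [e] an
    edge passes as a cycle on two vertices. *)
Definition mcyc (s : seq V) := [&& s != [::], uniq s & (size s == 1) || cycle e s].

Lemma mcyc_uniq s : mcyc s -> uniq s.
Proof. by case/and3P. Qed.

Lemma cycle_sorted s : cycle e s -> sorted e s.
Proof. by case: s => //= x s; rewrite rcons_path => /andP[]. Qed.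

Lemma mcyc_sorted s : mcyc s -> sorted e s.
Proof. by case/and3P => _ _ /orP[|/cycle_sorted //]; case: s => [|x []]. Qed.

(* The first vertex of a longest path has all its neighbours on the path, so it
   can be added to any stable set avoiding the cycle cut off by the last of
   them. *)
Lemma posa_step S : S != set0 ->
  exists s, [/\ mcyc s, {subset s <= S} & alpha (S :\: [set z in s]) < alpha S].
Proof.
case/set0Pn => x0 x0S.
pose ok n := [exists t : n.-tuple V, [&& uniq t, sorted e t & all (mem S) t]].
have ok1 : ok 1 by apply/existsP; exists [tuple x0]; rewrite /= x0S.
have okub n : ok n -> n <= #|V|.
  case/existsP => t /and3P[ut _ _]; rewrite -[n](size_tuple t) -(card_uniqP ut).
  exact: max_card.
case: (ex_maxnP (ex_intro _ 1 ok1) okub) => n /existsP[[t tn] /= /and3P[ut st aS]] nmax.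
case: t => [|v p] in tn ut st aS.
  by move/eqP: tn => /= n0; have := nmax _ ok1; rewrite -n0.
have nb u : u \in S -> e v u -> u \in v :: p.
  move=> uS vu; apply/negPn/negP => up.
  have : ok n.+1.
    apply/existsP; exists (@Tuple n.+1 V (u :: v :: p) (tn : size (u :: v :: p) == n.+1)).
    by rewrite /= up uS e_sym vu; move: ut st aS => /= -> -> ->.
  by move/nmax; rewrite ltnn.
have vS : v \in S by move/andP: aS => [].
suff [s [ms ss vs hs]] : exists s, [/\ mcyc s, {subset s <= v :: p}, v \in s &
    forall u, u \in S -> e v u -> u \in s].
  exists s; split => //; first by move=> z /ss; apply: (allP aS).
  have [I sI [IS <-]] := alpha_ex (S :\: [set z in s]).
  have vI : v \notin I.
    by apply/negP => /(subsetP IS); rewrite !inE vs.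
  have <- : #|v |: I| = #|I|.+1 by rewrite cardsU1 vI.
  apply: alpha_ge; last first.
    by rewrite subUset sub1set vS (subset_trans IS) ?subsetDl.
  apply: stableU1 => // y /(subsetP IS); rewrite !inE => /andP[ys yS].
  by apply: contra ys; apply: hs.
have [nbp|] := boolP (has (e v) p); last first.
  move/hasPn => nn; exists [:: v]; split => //; rewrite ?inE //.
    by move=> z; rewrite inE => /eqP->; rewrite inE eqxx.
  move=> u uS vu; have := nb u uS vu; rewrite !inE => /orP[/eqP-> //|up].
  by move: (nn u up); rewrite vu.
have [q1 [w [q2 [vw nq2 pE]]]] : exists q1 w q2,
    [/\ e v w, ~~ has (e v) q2 & p = q1 ++ w :: q2].
  elim: (p) nbp => // a q IH /=; case: (boolP (has (e v) q)) => [/IH h _|nq].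
    by case: h => q1 [w [q2 [vw nq2 ->]]]; exists (a :: q1), w, q2.
  by rewrite orbF => va; exists [::], a, q.
exists (v :: rcons q1 w); split; rewrite ?mem_head //.
- rewrite /mcyc; apply/andP; split=> //; apply/andP; split.
    by move: ut; rewrite pE /= -cat_rcons mem_cat cat_uniq negb_or => /andP[/andP[-> _] /and3P[->]].
  apply/orP; right; move: st; rewrite pE /= -cat_rcons cat_path => /andP[st _].
  by rewrite rcons_path /= st /= last_rcons e_sym.
- move=> z; rewrite pE -cat_rcons -cat_cons mem_cat => ->//.
- move=> u uS vu; have := nb u uS vu; rewrite pE -cat_rcons -cat_cons mem_cat.
  by case/orP => // /(hasPn nq2); rewrite vu.
Qed.

(** The cycles are kept disjoint because, cut open, they also serve as a partition of [S] into
    paths. *)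
Lemma posa S : exists ss : seq (seq V),
  [/\ all mcyc ss, uniq (flatten ss), flatten ss =i S & size ss <= alpha S].
Proof.
have [n] := ubnP #|S|; elim: n S => // n IH S; rewrite ltnS => Sn.
have [->|S0] := eqVneq S set0.
  by exists [::]; split => // z; rewrite inE.
have [s [ms ss als]] := posa_step S0.
have [|ss' [ms' us' ess' szs']] := IH (S :\: [set z in s]).
  apply: leq_trans Sn; apply: proper_card; apply/properP; split; first exact: subsetDl.
  case: s ms ss {als} => // x s ms ss.
  by exists x; rewrite ?ss ?inE ?eqxx // mem_head.
exists (s :: ss'); split => /=.
- by rewrite ms.
- rewrite cat_uniq us' andbT (mcyc_uniq ms) /=.
  by apply/hasPn => z; rewrite ess' !inE => /andP[].
- move=> z; rewrite mem_cat ess' !inE.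
  by case: (boolP (z \in s)) => [/ss ->|].
- exact: leq_ltn_trans szs' als.
Qed.
End Stable.

(** * Cycles through prescribed blocks *)

Section Flatten.
Context (V : finType) (e : rel V).
Implicit Types (s b ys : seq V) (B Ps : seq (seq V)).

Definition blink x0 b b' := e (last x0 b) (head x0 b').

Lemma path_flatten x0 x s B : path e x s ->
    all (fun b => (b != [::]) && sorted e b) B -> path (blink x0) (x :: s) B ->
  path e x (s ++ flatten B) /\ last x (s ++ flatten B) = last x0 (last (x :: s) B).
Proof.
elim: B x s => [|[|y b] B IH] x s //= ps; first by rewrite cats0.
move=> /andP[sb aB] /andP[lk pB]; have [h1 h2] := IH y b sb aB pB.
by rewrite cat_path ps /= last_cat /= -h2; split => //; rewrite h1 andbT.
Qed.

Lemma cycle_flatten x0 B : all (fun b => (b != [::]) && sorted e b) B ->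
  cycle (blink x0) B -> cycle e (flatten B).
Proof.
case: B => [|[|x s] B] //= /andP[sb aB]; rewrite rcons_path => /andP[pB lB].
have [h1 h2] := path_flatten sb aB pB.
by rewrite rcons_path h1 h2; exact: lB.
Qed.

Lemma cycle_total (T : eqType) (r : rel T) (t : seq T) :
  {in t &, forall a a', r a a'} -> cycle r t.
Proof.
case: t => // a t h /=.
suff H C d : d \in a :: t -> {subset C <= a :: t} -> path r d C.
  by apply: H; [exact: mem_head | move=> z; rewrite mem_rcons].
elim: C d => //= c C IH d dt sC.
have ct : c \in a :: t by apply: sC; exact: mem_head.
rewrite h //=; apply: IH => // z zC; apply: sC; by rewrite inE zC orbT.
Qed.

Definition interleave ys Ps := flatten [seq yP.1 :: yP.2 | yP <- zip ys Ps].

Lemma perm_interleave ys Ps : size ys = size Ps ->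
  perm_eq (interleave ys Ps) (ys ++ flatten Ps).
Proof.
rewrite /interleave; elim: ys Ps => [|y ys IH] [|P Ps] //= [sz].
by rewrite perm_cons perm_sym perm_catCA perm_cat2l perm_sym IH.
Qed.

Lemma mcyc_interleave x0 ys Ps : size ys = size Ps -> ys != [::] ->
    uniq (ys ++ flatten Ps) -> all (fun b => (b != [::]) && sorted e b) Ps ->
    cycle (blink x0) [seq yP.1 :: yP.2 | yP <- zip ys Ps] ->
    (forall yP, yP \in zip ys Ps -> e yP.1 (head x0 yP.2)) ->
  mcyc e (interleave ys Ps).
Proof.
move=> sz ys0 un aP cy hd; apply/and3P; split.
- by case: ys Ps sz ys0 {un aP cy hd} => [|y ys] [|P Ps].
- by rewrite (perm_uniq (perm_interleave sz)).
apply/orP; right; apply: (cycle_flatten (x0 := x0)) => //.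
apply/allP => b /mapP[[y P] yP ->] /=.
have PPs : P \in Ps.
  have /= := map_f snd yP; rewrite -/unzip2 unzip2_zip ?sz //.
move/allP: aP => /(_ _ PPs); have := hd _ yP.
by case: P {yP PPs} => //= p P -> ->.
Qed.

Lemma mcyc_inter_total x0 ys Ps : size ys = size Ps -> ys != [::] ->
    uniq (ys ++ flatten Ps) -> all (fun b => (b != [::]) && sorted e b) Ps ->
    (forall y P, y \in ys -> P \in Ps -> e y (head x0 P) && e (last x0 P) y) ->
  mcyc e (interleave ys Ps).
Proof.
move=> sz ys0 un aP cc.
have zz y P : (y, P) \in zip ys Ps -> y \in ys /\ P \in Ps.
  move=> yP; have := map_f fst yP; have := map_f snd yP.
  by rewrite -/unzip1 -/unzip2 unzip2_zip ?unzip1_zip ?sz.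
apply: (mcyc_interleave (x0 := x0)) => //.
  apply: cycle_total => _ _ /mapP[[y P] yP ->] /mapP[[y' P'] yP' ->] /=.
  have [_ PPs] := zz _ _ yP; have [y'ys _] := zz _ _ yP'.
  have /andP[_] := cc _ _ y'ys PPs; move/allP: aP => /(_ _ PPs).
  by case: P {yP PPs}.
by move=> [y P] /zz [yys /(cc _ _ yys)/andP[]].
Qed.

(** Each cycle alternates all of [ys] with [size ys] blocks; [ys] is used again in every cycle, so
    [N] cycles can absorb [N * size ys] blocks. *)
Lemma cycles_through_blocks x0 ys Ps N : ys != [::] ->
    uniq (ys ++ flatten Ps) -> all (fun b => (b != [::]) && sorted e b) Ps ->
    (forall y P, y \in ys -> P \in Ps -> e y (head x0 P) && e (last x0 P) y) ->
    size ys <= size Ps <= N * size ys ->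
  exists cs, [/\ all (mcyc e) cs, size cs <= N & {subset ys ++ flatten Ps <= flatten cs}].
Proof.
move=> ys0; elim: N Ps => [|N IH] Ps un aP cc /andP[h1 h2].
  by case: ys ys0 h1 h2 {un cc} => // y ys /=; lia.
set m := size ys in h1 h2.
have m0 : 0 < m by rewrite /m; case: (ys) ys0.
have sub n0 n1 Qs : Qs = take n0 (drop n1 Ps) -> [/\ uniq (ys ++ flatten Qs),
    all (fun b => (b != [::]) && sorted e b) Qs &
    forall y P, y \in ys -> P \in Qs -> e y (head x0 P) && e (last x0 P) y].
  move=> ->; have sQ : {subset take n0 (drop n1 Ps) <= Ps} by move=> z /mem_take /mem_drop.
  split; first 1 last.
  - by apply/allP => z /sQ; apply: (allP aP).
  - by move=> y P yys /sQ; apply: cc.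
  apply: (subseq_uniq _ un); rewrite cat_subseq //.
  rewrite -{2}[Ps](cat_take_drop n1) -{2}[drop n1 Ps](cat_take_drop n0) !flatten_cat.
  apply: subseq_trans (suffix_subseq _ _); exact: prefix_subseq.
have one Qs n0 n1 : Qs = take n0 (drop n1 Ps) -> size Qs = m -> mcyc e (interleave ys Qs).
  by move=> /sub [h h' h''] sQ; apply: (mcyc_inter_total (x0 := x0)).
have memi Qs z : size Qs = m -> (z \in interleave ys Qs) = (z \in ys ++ flatten Qs).
  by move=> sQ; rewrite (perm_mem (perm_interleave _)).
have s1 : size (take m Ps) = m by rewrite size_take; case: ltngtP h1; lia.
have c1 : mcyc e (interleave ys (take m Ps)).
  by apply: (one _ m 0) => //; rewrite drop0.
have [big|small] := leqP (2 * m) (size Ps).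
  have [|un' aP' cc'] := sub (size Ps) m (drop m Ps).
    by rewrite take_oversize // size_drop leq_subr.
  have [|cs [acs scs sub']] := IH _ un' aP' cc'.
    by rewrite size_drop; nia.
  exists (interleave ys (take m Ps) :: cs); rewrite /= c1; split => //.
  move=> z; rewrite -{1}[Ps](cat_take_drop m) flatten_cat !mem_cat memi // mem_cat.
  case/or3P => [->|->|zD]; rewrite ?orbT //.
  by rewrite sub' ?orbT // mem_cat zD orbT.
have [eqm|neqm] := eqVneq (size Ps) m.
  exists [:: interleave ys Ps]; split => //=.
    by rewrite andbT; apply: (mcyc_inter_total (x0 := x0)).
  by move=> z; rewrite cats0 memi.
(* More than [m] but fewer than [2 * m] blocks are left: the first [m] and the last [m] of them give
   two cycles that overlap, which is allowed. *)
have s2 : size (drop (size Ps - m) Ps) = m by rewrite size_drop; lia.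
exists [:: interleave ys (take m Ps); interleave ys (drop (size Ps - m) Ps)].
split => /=.
- rewrite c1 andbT /=; apply: (one _ (size Ps) (size Ps - m)) => //.
  by rewrite take_oversize // size_drop leq_subr.
- by case: (N) h2 neqm; lia.
move=> z; rewrite cats0 !mem_cat !memi // !mem_cat.
case/orP => [->//|/flattenP[P PPs zP]].
have : P \in take m Ps ++ drop (size Ps - m) Ps.
  have := PPs; rewrite -{1}[Ps](cat_take_drop m) !mem_cat => /orP[->//|PD].
  apply/orP; right; apply: (@mem_drop (m - (size Ps - m))).
  by rewrite drop_drop; have -> : (m - (size Ps - m)) + (size Ps - m) = m by lia.
rewrite mem_cat => /orP[]PP; apply/orP; [left|right]; apply/orP; right.
  by apply/flattenP; exists P.
by apply/flattenP; exists P.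
Qed.
End Flatten.

(** * Covers, path partitions and complete bipartite pairs *)

Section Cover.
Context (V : finType) (e : rel V).
Implicit Types (S X Y : {set V}) (ss : seq (seq V)).

Definition covers N S :=
  exists cs, [/\ all (mcyc e) cs, size cs <= N & {subset S <= flatten cs}].

Lemma coversS N N' S S' : N <= N' -> S' \subset S -> covers N S -> covers N' S'.
Proof.
move=> NN SS [cs [h1 h2 h3]]; exists cs; split => //; first exact: leq_trans NN.
by move=> z /(subsetP SS); apply: h3.
Qed.

Lemma coversU N N' S S' : covers N S -> covers N' S' -> covers (N + N') (S :|: S').
Proof.
move=> [cs [h1 h2 h3]] [cs' [h1' h2' h3']]; exists (cs ++ cs'); split.
- by rewrite all_cat h1.
- by rewrite size_cat leq_add.
- by move=> z; rewrite flatten_cat mem_cat inE => /orP[/h3|/h3']->; rewrite ?orbT.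
Qed.

Lemma covers_cyc s S : mcyc e s -> {subset S <= s} -> covers 1 S.
Proof. by move=> ms sS; exists [:: s]; rewrite /= ms cats0. Qed.

Lemma covers_card S : covers #|S| S.
Proof.
exists [seq [:: x] | x <- enum S]; split; last 1 first.
- move=> z zS; apply/flattenP; exists [:: z]; rewrite ?inE //.
  by apply: map_f; rewrite mem_enum.
- by apply/allP => _ /mapP[x _ ->].
- by rewrite size_map -cardE.
Qed.

Definition path_partition S ss :=
  [/\ all (fun b => (b != [::]) && sorted e b) ss, uniq (flatten ss) & flatten ss =i S].

Lemma card_path_partition S ss : path_partition S ss -> #|S| = size (flatten ss).
Proof. by case=> _ us /eq_card <-; apply/card_uniqP. Qed.

Lemma path_partition_refine1 S ss : path_partition S ss -> size ss < #|S| ->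
  exists2 ss', path_partition S ss' & size ss' = (size ss).+1.
Proof.
move=> pp; rewrite (card_path_partition pp) size_flatten => lt.
have /hasP[s sss s1] : has (fun s => 1 < size s) ss.
  apply: contraLR lt => /hasPn h; rewrite -leqNgt.
  elim: ss {pp} h => //= s ss IH h; rewrite -add1n leq_add //.
    by rewrite leqNgt h ?mem_head.
  by apply: IH => t tss; apply: h; rewrite inE tss orbT.
case: pp; case/splitPr: sss => ss1 ss2 aP us fS.
case: s s1 aP us fS => // x [//|y s] _ aP us fS.
exists (ss1 ++ [:: x] :: (y :: s) :: ss2); last by rewrite !size_cat /= !addnS.
have fE : flatten (ss1 ++ [:: x] :: (y :: s) :: ss2) = flatten (ss1 ++ (x :: y :: s) :: ss2).
  by rewrite !flatten_cat.
split; rewrite ?fE //.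
by move: aP; rewrite !all_cat /= => /and3P[-> /andP[_ ->] ->].
Qed.

Lemma path_partition_refine S ss n : path_partition S ss -> size ss <= n <= #|S| ->
  exists2 ss', path_partition S ss' & size ss' = n.
Proof.
move=> pp /andP[]; elim: n => [|n IH] h1 h2.
  by exists ss => //; apply/eqP; rewrite -leqn0.
move: h1; rewrite leq_eqVlt => /predU1P[h1|h1]; first by exists ss.
have [ss' pp' sz'] := IH h1 (ltnW h2).
by have [|ss'' ? ?] := path_partition_refine1 pp'; rewrite ?sz' //; exists ss''; rewrite // -sz'.
Qed.

Hypothesis e_sym : symmetric e.
Hypothesis e_irr : irreflexive e.

Lemma posa_partition S : 
  exists ss, [/\ path_partition S ss, all (mcyc e) ss & size ss <= alpha e S].
Proof.
have [ss [ms us es sz]] := posa e_sym e_irr S; exists ss; split => //; split => //.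
apply/allP => s /(allP ms) m; rewrite (mcyc_sorted m) andbT.
by case/and3P: m.
Qed.

Lemma covers_posa N S : alpha e S <= N -> covers N S.
Proof.
have [ss [[_ us es] ms sz]] := posa_partition S => h; exists ss; split => //.
  exact: leq_trans h.
by move=> z; rewrite es.
Qed.

(** The smaller side supplies the single vertices and the larger one the blocks; if there are fewer
    than [#|Y|] paths, they are split further until [cycles_through_blocks] applies. *)
Lemma covers_bipartite_le X Y N Px : X != set0 -> Y != set0 -> [disjoint X & Y] ->
    {in X & Y, forall x y, e x y} -> #|Y| <= #|X| ->
    path_partition X Px -> size Px <= N * #|Y| -> covers N (X :|: Y).
Proof.
move=> X0 Y0 dXY cc YX pX szX.
have N0 : 0 < N.
  case: N szX => // ; rewrite mul0n leqn0 size_eq0 => /eqP Px0.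
  by case/set0Pn: X0 => x; case: pX => _ _ <-; rewrite Px0.
have [Px' pX' /andP[l1 l2]] : exists2 Px', path_partition X Px' & #|Y| <= size Px' <= N * #|Y|.
  case: (leqP #|Y| (size Px)) => h; first by exists Px; rewrite // h.
  have [|Px' pX' sz'] := @path_partition_refine X Px #|Y| pX; first by rewrite ltnW.
  by exists Px' => //; rewrite sz' leqnn leq_pmull.
case/set0Pn: (X0) => x0 _; case: pX' => aP uP eP.
have [|||||cs [h1 h2 h3]] := @cycles_through_blocks V e x0 (enum Y) Px' N.
- by rewrite -size_eq0 -cardE cards_eq0.
- rewrite cat_uniq enum_uniq uP andbT /=; apply/hasPn => z; rewrite eP mem_enum => zX.
  by apply: contraTN zX => zY; rewrite (disjointFl dXY).
- exact: aP.
- move=> y P; rewrite mem_enum => yY PP.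
  have hP p : p \in P -> p \in X.
    by move=> pP; rewrite -eP; apply/flattenP; exists P.
  case: P {PP} (allP aP _ PP) hP => //= p P _ hP.
  by rewrite e_sym !cc // hP // ?mem_head // mem_last.
- by rewrite -cardE l1 l2.
exists cs; split => // z; rewrite inE => zXY; apply: h3.
by rewrite mem_cat mem_enum eP orbC.
Qed.

Lemma covers_bipartite X Y N Px Py : X != set0 -> Y != set0 -> [disjoint X & Y] ->
    {in X & Y, forall x y, e x y} ->
    path_partition X Px -> size Px <= N * #|Y| -> path_partition Y Py -> size Py <= N * #|X| ->
  covers N (X :|: Y).
Proof.
move=> X0 Y0 dXY cc pX szX pY szY; have [YX|/ltnW XY] := leqP #|Y| #|X|.
  exact: covers_bipartite_le szX.
rewrite setUC; apply: covers_bipartite_le pY _ => //; first by rewrite disjoint_sym.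
by move=> x y xX yY; rewrite e_sym cc.
Qed.

Lemma covers_bipartite_alpha X Y N : X != set0 -> Y != set0 -> [disjoint X & Y] ->
    {in X & Y, forall x y, e x y} ->
    alpha e X <= N * #|Y| -> alpha e Y <= N * #|X| -> covers N (X :|: Y).
Proof.
move=> X0 Y0 dXY cc aX aY.
have [Px [pX _ sX]] := posa_partition X; have [Py [pY _ sY]] := posa_partition Y.
by apply: (covers_bipartite X0 Y0 dXY cc pX _ pY); [apply: leq_trans aX|apply: leq_trans aY].
Qed.
End Cover.

(** * Two disjoint paths *)

Section Menger.
Context (V : finType) (e : rel V).
Implicit Types (S N B : {set V}) (s t : seq V).

Definition npath S N B s := [&& sorted e s, uniq s, all (mem S) s &
  if s is h :: t then (h \in N) && (last h t \in B) else false].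

Lemma npath_S S N B s : npath S N B s -> {subset s <= S}.
Proof. by case/and4P => _ _ /allP. Qed.

Lemma npath_uniq S N B s : npath S N B s -> uniq s.
Proof. by case/and4P. Qed.

Lemma npath_suffix S N B s h t : npath S N B (s ++ h :: t) ->
  forall N', h \in N' -> npath S N' B (h :: t).
Proof.
case/and4P => h1 h2 h3 h4 N' hN; apply/and4P; split.
- by case: (s) h1 => [|a q] //=; rewrite cat_path /= => /and3P[].
- by move: h2; rewrite cat_uniq => /and3P[].
- by move: h3; rewrite all_cat => /andP[].
- by rewrite hN; case: (s) h4 => [|a q] /andP[_]; rewrite ?last_cat.
Qed.

(* Contract a vertex of [N] into the source: if the two paths found in the
   smaller graph both start at neighbours of that vertex, then a path avoiding
   it reroutes one of them. *)
Lemma menger2 S N B (x0 : V) :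
    (forall v, exists2 s, npath S N B s & v \notin s) ->
  exists s t, [/\ npath S N B s, npath S N B t & [disjoint s & t]].
Proof.
have [n] := ubnP #|S|; elim: n S N => // n IH S N; rewrite ltnS => Sn sep.
have [/existsP[b /and3P[bS bN bB]]|] := boolP [exists b, [&& b \in S, b \in N & b \in B]].
  have [s ns bs] := sep b; exists [:: b], s; split => //.
    by rewrite /npath /= bS bN bB.
  by rewrite disjoint_has /= orbF.
move=> /existsPn nb.
have [[|v r] nvr _] := sep x0; first by case/and4P: nvr.
have vS : v \in S by apply: (npath_S nvr); exact: mem_head.
have vN : v \in N by case/and4P: nvr => _ _ _ /andP[].
have vB : v \notin B by have := nb v; rewrite vS vN.
pose S' := S :\ v; pose N' := (N :\ v) :|: [set u | e v u].
have S'S : S' \subset S by rewrite subD1set.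
have [||s [t [ns nt dst]]] := IH S' N'.
- by apply: leq_trans Sn; rewrite [#|S|](cardsD1 v) vS.
- move=> w; have [s ns ws] := sep w.
  have [vs|vs] := boolP (v \in s); last first.
    exists s => //; case/and4P: (ns) => h1 h2 /allP h3 h4; apply/and4P; split => //.
      apply/allP => z zs; rewrite !inE; have /= -> := h3 z zs.
      by rewrite andbT; apply: contraNneq vs => <-.
    case: s h4 vs {ns ws h1 h2 h3} => // h s /andP[hN ->] vs.
    rewrite !inE hN andbT andbT; apply/orP; left.
    by apply: contraNneq vs => ->; exact: mem_head.
  case/splitPr: vs ns ws => s1 [|u s2] ns ws.
    case/and4P: ns => _ _ _; case: s1 {ws} => [|a s1] /=;
      by rewrite ?last_cat /= (negbTE vB) ?andbF.
  exists (u :: s2); last first.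
    by apply: contra ws => ws; rewrite mem_cat inE ws !orbT.
  have vu : e v u.
    case/and4P: ns => h1 _ _ _; case: s1 h1 {ws} => [|a s1] /=; first by case/andP.
    by rewrite cat_path /= => /and3P[_ _ /andP[]].
  move: ns; rewrite -cat_rcons => ns; have uq := npath_uniq ns.
  have /and4P[h1 h2 h3 h4] := npath_suffix ns (N' := N') ltac:(by rewrite !inE vu orbT).
  apply/and4P; split => //; apply/allP => z zs; rewrite !inE.
  have /= -> := allP h3 z zs; rewrite andbT; apply: contraTneq uq => zv.
  rewrite cat_uniq; apply/negP => /and3P[_ /hasP[]]; exists v; first by rewrite -zv.
  by rewrite /= mem_rcons mem_head.
have vns q : npath S' N' B q -> v \notin q.
  by move=> nq; apply/negP => /(npath_S nq); rewrite !inE eqxx.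
have lift q : npath S' N' B q -> npath S N B q \/ npath S N B (v :: q).
  move=> nq; have := vns q nq; case/and4P: nq; case: q => // h q h1 h2 h3.
  rewrite !inE => /andP[/orP[/andP[_ hN]|vh] hB] /norP[vh' vq]; [left|right].
    by rewrite /npath h1 h2 hN hB (sub_all _ h3) // => z /(subsetP S'S).
  have h3' : all (mem S) (h :: q) by apply: (sub_all _ h3) => z /(subsetP S'S).
  apply/and4P; split.
  - by rewrite /= vh.
  - by rewrite cons_uniq h2 andbT inE negb_or vh' vq.
  - by apply/andP.
  - by rewrite vN.
have disj_cons (q q' : seq V) : v \notin q' -> [disjoint q & q'] -> [disjoint v :: q & q'].
  by move=> vq' dqq'; rewrite disjoint_cons vq'.
have [ls|ls] := lift s ns.
  have [lt|lt] := lift t nt; first by exists s, t.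
  exists s, (v :: t); split => //; rewrite disjoint_sym.
  by rewrite disjoint_cons vns // disjoint_sym.
have [lt|lt] := lift t nt.
  by exists (v :: s), t; split => //; apply: disj_cons => //; apply: vns.
have [r' nr' vr'] := sep v.
have [/hasP[z zr zst]|nst] := boolP (has (mem (s ++ t)) r'); last first.
  exists r', (v :: s); split => //.
  rewrite disjoint_sym disjoint_cons vr' /= disjoint_sym disjoint_has.
  by apply: contra nst => /hasP[w wr ws]; apply/hasP; exists w; rewrite //= mem_cat ws.
(* The path [r'] avoids [v]. Up to its first vertex [h] on [s] or [t] it is new, and from [h] on it
   follows that path; the other path is prolonged by [v]. *)
have [h [r1 [r2 [rE nr1 hst]]]] : exists h r1 r2,
    [/\ r' = r1 ++ h :: r2, ~~ has (mem (s ++ t)) r1 & h \in s ++ t].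
  have hs : has (mem (s ++ t)) r' by apply/hasP; exists z.
  elim: (r') hs => // a q IHq /=; have [/= aq _|/= aq] := boolP (a \in s ++ t).
    by exists a, [::], q.
  case/IHq => h [r1 [r2 [-> h1 h2]]]; exists h, (a :: r1), r2; split => //=.
  by rewrite (negbTE aq).
wlog hs : s t ns nt dst ls lt nr1 hst {zst} / h \in s.
  move=> wl; have := hst; rewrite mem_cat => /orP[] hh.
    exact: (wl s t).
  apply: (wl t s) => //; rewrite 1?disjoint_sym //; last by rewrite mem_cat hh.
  by rewrite (eq_has (a2 := mem (s ++ t))) // => w; rewrite /= !mem_cat orbC.
have [s1 [s2 sE]] : exists s1 s2, s = s1 ++ h :: s2.
  by case/splitPr: hs => s1 s2; exists s1, s2.
have nst w : w \in r1 -> w \notin s ++ t by move=> /(hasPn nr1).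
exists (r1 ++ h :: s2), (v :: t); split => //; last first.
  rewrite disjoint_sym disjoint_cons mem_cat; apply/andP; split.
    apply/norP; split; first by apply: contra vr'; rewrite rE mem_cat => ->.
    by apply: contra (vns s ns); rewrite sE mem_cat => ->; rewrite orbT.
  rewrite disjoint_has; apply/hasPn => w wt /=; rewrite mem_cat.
  apply/norP; split; first by apply/negP => /nst; rewrite mem_cat wt orbT.
  apply: contraTN dst => ws; rewrite disjoint_has negbK; apply/hasP; exists w => //.
  by rewrite sE mem_cat ws orbT.
have ns' := ns; rewrite sE in ns'; have nsh := npath_suffix ns' (set11 h).
have [g1 g2 g3 g4] := and4P nsh; have [f1 f2 f3 f4] := and4P nr'.
rewrite /npath; apply/and4P; split.
- move: f1; rewrite rE; case: (r1) => [|a q] //=; rewrite !cat_path /= => /and3P[-> -> _].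
  exact: g1.
- rewrite cat_uniq g2 andbT; move: f2; rewrite rE cat_uniq => /and3P[u1 _ _].
  apply/andP; split=> //; apply/hasPn => w wh; apply/negP => /nst; rewrite mem_cat sE mem_cat.
  by rewrite wh !orbT.
- rewrite all_cat; move: f3; rewrite rE all_cat => /andP[-> _] /=.
  by apply: (sub_all _ g3) => w /(subsetP S'S).
- move: f4 g4; rewrite rE; case: (r1) => [|a q] /= /andP[-> _] /andP[_ gB] //.
  by rewrite last_cat.
Qed.
End Menger.

(** * Boundaries, reachability and the gates of a component *)

Definition bd (V : finType) (e : rel V) (Y : {set V}) :=
  [set u | (u \notin Y) && [exists y in Y, e y u]].

Section Reach.
Context (V : finType) (e : rel V) (x : V).
Implicit Types (A : {set V}).

Definition avoid A : rel V := fun a b => [&& e a b, a \notin A & b \notin A].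
Definition reach A := [set v | connect (avoid A) x v].

Lemma avoid_path A y s : y \notin A -> path (avoid A) y s = path e y s && all [predC A] s.
Proof.
elim: s y => //= z s IH y yA; rewrite /avoid yA /= -/(avoid A).
case: (boolP (z \in A)) => zA; rewrite ?andbF //= andbT.
by rewrite IH // andbA.
Qed.

Lemma reach_root A : x \in reach A.
Proof. by rewrite inE connect0. Qed.

Lemma reachP A v : x \notin A -> reflect (exists s, [/\ path e x s, uniq (x :: s),
  all [predC A] s & v = last x s]) (v \in reach A).
Proof.
move=> xA; rewrite inE; apply: (iffP connectP) => [[s ps ->]|[s [ps us aA ->]]].
  case: (shortenP ps) => t pt ut _; exists t; split => //.
    by move: pt; rewrite avoid_path // => /andP[].
  by move: pt; rewrite avoid_path // => /andP[].
by exists s => //; rewrite avoid_path // ps.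
Qed.

Lemma reach_notin A v : x \notin A -> v \in reach A -> v \notin A.
Proof.
move=> xA /(reachP _ xA)[s [_ _ aA ->]].
by have := mem_last x s; rewrite inE => /predU1P[->//|/(allP aA)].
Qed.

Lemma reach_step A u v : x \notin A -> u \in reach A -> e u v -> v \notin A -> v \in reach A.
Proof.
move=> xA uR uv vA; have uA := reach_notin xA uR.
move: uR; rewrite !inE => h; apply: connect_trans h _; apply: connect1.
by rewrite /avoid uv uA.
Qed.

Lemma reach_path A u s : x \notin A -> u \in reach A -> path e u s ->
  all [predC A] s -> {subset s <= reach A}.
Proof.
move=> xA; elim: s u => //= v s IH u uR /andP[uv ps] /andP[vA aA].
have vR := reach_step xA uR uv vA.
by move=> z; rewrite inE => /predU1P[->//|]; apply: (IH v).
Qed.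
End Reach.

Section Links.
Context (V : finType) (e : rel V) (e_sym : symmetric e).
Context (C : {set V}) (x : V) (xC : x \notin C).

Definition comp := reach e x C.
Definition attach := [set p in C | [exists u in comp, e u p]].
(** Dominators in the sense of flow graphs: every route from [x] through its component to [p] passes
    [t]. *)
Definition dom t p :=
  [&& t \in comp, t != x & ~~ [exists u in reach e x (t |: C), e u p]].
(** The dominators of an attachment form a chain ([dom_order]); the gate is the one nearest to [x],
    singled out by the smallest region before it. *)
Definition gate p :=
  if [pick t | dom t p] is Some t0 then [arg min_(t < t0 | dom t p) #|reach e x (t |: C)|]
  else p.

Lemma comp_root : x \in comp. Proof. exact: reach_root. Qed.

Lemma comp_notin v : v \in comp -> v \notin C.
Proof. exact: reach_notin. Qed.

Lemma attachP p : reflect (p \in C /\ exists2 u, u \in comp & e u p) (p \in attach).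
Proof.
by rewrite inE; apply: (iffP andP) => -[h1] => [/exists_inP|/exists_inP]; split.
Qed.

Lemma domP t p : dom t p -> [/\ t \in comp, t != x, x \notin t |: C &
  forall u, u \in reach e x (t |: C) -> ~~ e u p].
Proof.
case/and3P => tK tx /exists_inPn h; split => //.
by rewrite !inE negb_or eq_sym tx.
Qed.

Lemma reach_dom t t' : x \notin t |: C -> x \notin t' |: C ->
  t' \notin reach e x (t |: C) -> reach e x (t |: C) \subset reach e x (t' |: C).
Proof.
move=> xt xt' t'R; apply/subsetP => v /(reachP _ _ xt)[s [ps us aA ->]].
have sR := reach_path xt (reach_root e x (t |: C)) ps aA.
have aA' : all [predC t' |: C] s.
  apply/allP => z zs /=; have := allP aA z zs; rewrite !inE !negb_or => /andP[_ ->].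
  by rewrite andbT; apply: contraNneq t'R => <-; apply: sR.
have := mem_last x s; rewrite inE => /predU1P[->|]; first exact: reach_root.
exact: (reach_path xt' (reach_root e x _) ps aA').
Qed.

(** Both vertices lie on any path from [x] to [p]. The one met first is reachable without the other;
    the later one is not reachable without the first, as the rest of the path would then lead to
    [p]. *)
Lemma dom_order t t' p : p \in attach -> dom t p -> dom t' p -> t != t' ->
  (reach e x (t |: C) \proper reach e x (t' |: C)) ||
  (reach e x (t' |: C) \proper reach e x (t |: C)).
Proof.
case/attachP => pC [u uK up] dt dt' tt'.
have [tK tx xt ht] := domP dt; have [t'K t'x xt' ht'] := domP dt'.
case/(reachP _ _ xC): (uK) => s [ps us aC uE].
have on v : x \notin v |: C -> (forall u, u \in reach e x (v |: C) -> ~~ e u p) -> v \in s.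
  move=> xv hv; apply: contraLR up => vs; apply: hv.
  apply/reachP => //; exists s; split => //; apply/allP => z zs /=.
  rewrite !inE negb_or; apply/andP; split; last exact: (allP aC).
  by apply: contraNneq vs => <-.
have ts := on _ xt ht; have t's := on _ xt' ht'.
wlog lt : t t' dt dt' tt' tK tx xt ht t'K t'x xt' ht' ts t's / index t s < index t' s.
  move=> wl; have [lt|lt|] := ltngtP (index t s) (index t' s); first exact: (wl t t').
    by rewrite orbC; apply: (wl t' t); rewrite // eq_sym.
  by move/(congr1 (nth t s)); rewrite !nth_index // => /eqP; rewrite (negbTE tt').
apply/orP; left.
case/splitPr: ts ps us aC uE t's lt => s1 s2 ps us aC uE t's lt.
move: us; rewrite cons_uniq cat_uniq => /and4P[xs us1 /hasPn ns12 /andP[ts2 us2]].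
have t's1 : t' \notin s1.
  have ts1 : t \notin s1 by apply: ns12; exact: mem_head.
  apply/negP => t's1; move: lt.
  by rewrite !index_cat t's1 (negbTE ts1) /= eqxx addn0 ltnNge index_size.
have t's2 : t' \in s2.
  by move: t's; rewrite mem_cat inE (negbTE t's1) eq_sym (negbTE tt').
have tR' : t \in reach e x (t' |: C).
  apply/reachP => //; exists (rcons s1 t); rewrite last_rcons; split => //.
  - by move: ps; rewrite -cat_rcons cat_path => /andP[].
  - rewrite cons_uniq rcons_uniq us1 andbT mem_rcons inE negb_or eq_sym tx /=.
    apply/andP; split; first by apply: contra xs; rewrite mem_cat => ->.
    by apply: ns12; exact: mem_head.
  - apply/allP => z; rewrite mem_rcons inE => zs.
    have zC : z \notin C.
      apply: (allP aC); rewrite mem_cat inE; case/orP: zs => ->; by rewrite ?orbT.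
    rewrite !inE negb_or zC andbT; case/predU1P: zs => [->|zs]; first exact: tt'.
    by apply: contraNneq t's1 => <-.
have t'R : t' \notin reach e x (t |: C).
  apply/negP => t'R; have uR : u \in reach e x (t |: C).
    case/splitPr: t's2 ps us2 ts2 aC uE {t's lt ns12 xs} => q1 q2 ps us2 ts2 aC uE.
    have := mem_last t' q2; rewrite inE.
    have -> : last t' q2 = u by rewrite uE !last_cat /= last_cat.
    case/predU1P => [->//|]; apply: (reach_path xt t'R).
      by move: ps; rewrite cat_path /= cat_path /= => /and3P[_ _ /and3P[]].
    apply/allP => z zq; rewrite !inE negb_or; apply/andP; split.
      by apply: contraNneq ts2 => <-; rewrite mem_cat inE zq !orbT.
    by apply: (allP aC); rewrite mem_cat inE mem_cat inE zq !orbT.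
  by have := ht _ uR; rewrite up.
apply/properP; split; first exact: reach_dom.
by exists t => //; apply/negP => /(reach_notin xt); rewrite !inE eqxx.
Qed.

Variant gate_spec p : V -> Prop :=
| GateSelf of (forall t, ~~ dom t p) : gate_spec p p
| GateDom t of dom t p & (forall t', dom t' p ->
    #|reach e x (t |: C)| <= #|reach e x (t' |: C)|) : gate_spec p t.

Lemma gateP p : gate_spec p (gate p).
Proof.
rewrite /gate; case: pickP => [t0 dt0|nd].
  by case: arg_minnP => // t dt mt; apply: GateDom.
by apply: GateSelf => t; rewrite nd.
Qed.

Lemma dom_trans t v p q : p \in attach -> dom v p -> dom v q -> dom t p ->
  (forall t', dom t' p -> #|reach e x (t |: C)| <= #|reach e x (t' |: C)|) -> dom t q.
Proof.
move=> pP dvp dvq dtp mt; have [->//|tv] := eqVneq t v.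
have [tK tx xt ht] := domP dtp; have [_ _ _ hv] := domP dvq.
case/orP: (dom_order pP dtp dvp tv) => [/proper_sub/subsetP sub|/proper_card].
  apply/and3P; split => //; apply/exists_inPn => u /sub; exact: hv.
by rewrite ltnNge mt.
Qed.

(** By [dom_trans] each of the two gates dominates both attachments; being comparable, they agree by
    minimality. *)
Lemma gate_eq v p q : p \in attach -> q \in attach -> dom v p -> dom v q ->
  gate p = gate q.
Proof.
move=> pP qP dvp dvq; case: (gateP p) => [/(_ v)|t dt mt]; first by rewrite dvp.
case: (gateP q) => [/(_ v)|t' dt' mt']; first by rewrite dvq.
have dtq := dom_trans pP dvp dvq dt mt; have dtp' := dom_trans qP dvq dvp dt' mt'.
apply/eqP/negPn/negP => tt'; case/orP: (dom_order pP dt dtp' tt') => /proper_card.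
  by rewrite ltnNge mt'.
by rewrite ltnNge mt.
Qed.

Lemma gate_root p : p \in attach -> gate p != x.
Proof.
case/attachP => pC _; case: (gateP p) => [_|t /domP[]//].
by apply: contraNneq xC => <-.
Qed.

(* Two attachments with distinct gates are not separated from [x] by a single
   vertex, so Menger's theorem joins them by a path through [x]. *)
Lemma link p q : p \in attach -> q \in attach -> gate p != gate q ->
  exists l, [/\ path e p (rcons l q), uniq l, {subset l <= comp} & x \in l].
Proof.
move=> pP qP gpq; have pq : p != q by apply: contraNneq gpq => ->.
pose S := (comp :\ x) :|: [set p; q]; pose N := [set u | e x u]; pose B := [set p; q].
have mk (A : {set V}) p' u : x \notin A -> C \subset A -> p' \in B -> p' \in C ->
    u \in reach e x A -> e u p' ->
    exists2 s, npath e S N B (rcons s p') & {in s, forall z, z \notin A}.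
  move=> xA CA p'B p'C /(reachP _ _ xA)[s [ps us aA ->]] lp.
  have aC : all [predC C] s by apply: (sub_all _ aA) => z /=; apply: contra; apply: (subsetP CA).
  exists s; last by move=> z /(allP aA).
  have ps' : path e x (rcons s p') by rewrite rcons_path ps.
  move: us; rewrite cons_uniq => /andP[xs us].
  apply/and4P; split.
  - by move: ps'; case: (s) => //= a r /andP[].
  - rewrite rcons_uniq us andbT; apply: contraL p'C => /(allP aC) //.
  - rewrite all_rcons; apply/andP; split; first by rewrite /= inE p'B orbT.
    apply/allP => z zs; apply/setUP; left; apply/setD1P; split.
      by apply: contraNneq xs => <-.
    exact: (reach_path xC (reach_root e x C) ps aC).
  - move: ps'; case: (s) => [|a r] /= /andP[h _]; rewrite inE h ?last_rcons //=.
(* A vertex [v != x] of the component does not dominate both [p] and [q], for then their gates would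
   agree; any other [v] blocks at most the end equal to it. *)
have key v : exists2 s, npath e S N B s & v \notin s.
  have [/andP[vK vx]|vK] := boolP ((v \in comp) && (v != x)).
    have xv : x \notin v |: C by rewrite !inE negb_or eq_sym vx.
    have [p' [p'B p'P dvp']] : exists p', [/\ p' \in B, p' \in attach & ~~ dom v p'].
      have [dvp|dvp] := boolP (dom v p); last by exists p; rewrite /B set21.
      exists q; rewrite /B set22; split => //.
      by apply: contra gpq => dvq; apply/eqP; exact: (gate_eq pP qP dvp dvq).
    move: dvp'; rewrite /dom vK vx /= negbK => /exists_inP[u uR up'].
    have p'C : p' \in C by case/attachP: p'P.
    have [s ns hs] := mk _ _ _ xv (subsetUr _ _) p'B p'C uR up'.
    exists (rcons s p') => //; rewrite mem_rcons inE negb_or.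
    apply/andP; split; first by apply: contraTneq vK => ->; apply: contraL p'C => /comp_notin.
    by apply/negP => /hs; rewrite !inE eqxx.
  have [p' [p'B p'P vp']] : exists p', [/\ p' \in B, p' \in attach & v != p'].
    have [->|vp] := eqVneq v p; last by exists p; rewrite /B set21.
    by exists q; rewrite /B set22.
  case/attachP: p'P => p'C [u uK up'].
  have [s ns hs] := mk _ _ _ xC (subxx _) p'B p'C uK up'.
  exists (rcons s p') => //; rewrite mem_rcons inE negb_or vp' /=.
  apply/negP => vs; move: vK; have vS : v \in S.
    by apply: (npath_S ns); rewrite mem_rcons inE vs orbT.
  have vC := hs _ vs; move: vS; rewrite !inE => /orP[/andP[-> ->]//|].
  by case/attachP: pP vC => pC _; case/attachP: qP => qC _ vC /orP[]/eqP vE;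
     rewrite vE ?pC ?qC in vC.
have [s [t [ns nt dst]]] := menger2 x key.
have sP u : npath e S N B u -> exists u' b, [/\ u = rcons u' b, b \in B & path e x u].
  move=> /and4P[h1 _ _]; case/lastP: u h1 => // u b h1.
  by case: u h1 => [|a r] /= h1 /andP[]; rewrite inE => h2; rewrite ?last_rcons => h3;
     [exists [::], b | exists (a :: r), b]; split => //=; rewrite h2.
have [s' [b [sE bB ps]]] := sP _ ns; have [t' [b' [tE b'B pt]]] := sP _ nt.
have bb' : b != b'.
  apply: contraTneq dst => bb; rewrite disjoint_has negbK; apply/hasP; exists b.
    by rewrite sE mem_rcons mem_head.
  by rewrite /= tE mem_rcons bb mem_head.
wlog [bE b'E] : s t ns nt dst s' t' b b' sE tE ps pt bB b'B bb' / b = p /\ b' = q.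
  move=> wl; move: bB b'B; rewrite !inE => /orP[]/eqP bE /orP[]/eqP b'E.
  - by move: bb'; rewrite bE b'E eqxx.
  - by apply: (wl s t ns nt dst s' t' b b'); rewrite // ?inE ?bE ?b'E eqxx ?orbT.
  - apply: (wl t s nt ns _ t' s' b' b); rewrite // 1?disjoint_sym // 1?eq_sym //
      ?inE ?bE ?b'E ?eqxx ?orbT //.
  - by move: bb'; rewrite bE b'E eqxx.
subst b b' s t.
have ds (z : V) : z \in rcons s' p -> z \notin rcons t' q.
  by move=> zs; rewrite (disjointFr dst).
have us := npath_uniq ns; have ut := npath_uniq nt.
have s'K : {subset s' <= comp :\ x}.
  move=> z zs; have := npath_S ns; move/(_ z); rewrite mem_rcons inE zs orbT => /(_ isT).
  have : z != p by apply: contraTneq us => <-; rewrite rcons_uniq zs.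
  have : z != q.
    apply: contraTneq zs => ->; apply/negP => qs.
    by have := ds q; rewrite !mem_rcons !inE qs orbT eqxx => /(_ isT).
  by rewrite !inE => /negbTE-> /negbTE->; rewrite !orbF.
have t'K : {subset t' <= comp :\ x}.
  move=> z zs; have := npath_S nt; move/(_ z); rewrite mem_rcons inE zs orbT => /(_ isT).
  have : z != q by apply: contraTneq ut => <-; rewrite rcons_uniq zs.
  have : z != p.
    apply: contraTneq zs => ->; apply/negP => qs.
    by have := ds p; rewrite !mem_rcons !inE qs orbT eqxx => /(_ isT).
  by rewrite !inE => /negbTE-> /negbTE->; rewrite !orbF.
exists (rev s' ++ x :: t'); split.
- rewrite rcons_cat rcons_cons -cat_rcons cat_path last_rcons pt andbT.
  have := rev_path e x (rcons s' p); rewrite last_rcons belast_rcons rev_cons.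
  by rewrite (eq_path (e' := e)) => [->|a b /=]; rewrite 1?e_sym.
- move: us ut; rewrite !rcons_uniq => /andP[_ us'] /andP[_ ut'].
  rewrite cat_uniq rev_uniq us' cons_uniq ut' andbT /=; apply/andP; split.
    rewrite negb_or !mem_rev; apply/andP; split.
      by apply/negP => /s'K; rewrite inE set11.
    apply/hasPn => z zt /=; rewrite mem_rev; apply/negP => zs.
    by have := ds z; rewrite !mem_rcons !inE zs zt !orbT => /(_ isT).
  by apply/negP => /t'K; rewrite inE set11.
- move=> z; rewrite mem_cat mem_rev inE => /or3P[/s'K|/eqP->|/t'K]; rewrite ?comp_root //;
    by rewrite inE => /andP[].
- by rewrite mem_cat mem_head orbT.
Qed.

(** A boundary vertex in [C] is an attachment. Unless it is its own gate, its gate dominates it, and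
    the region [Y], which avoids all gates, cannot be adjacent to it. Lower bounds on separators of
    [x] thus become lower bounds on the number of gates. *)
Lemma gate_bd : let Y := reach e x (C :|: gate @: attach) in
  [/\ x \in Y, [disjoint Y & C] & bd e Y \subset gate @: attach].
Proof.
set W := gate @: attach => Y.
have xW : x \notin C :|: W.
  rewrite inE negb_or xC; apply/negP => /imsetP[p pP xE].
  by have := gate_root pP; rewrite -xE eqxx.
have YC y : y \in Y -> y \notin C :|: W by apply: reach_notin.
split; first exact: reach_root.
  apply/pred0P => y /=; apply/negP => /andP[/YC]; rewrite inE negb_or.
  by case/andP => /negbTE->.
have YK t : t \in C :|: W -> x \notin t |: C -> Y \subset reach e x (t |: C).
  move=> tW xt; apply/subsetP => v /(reachP _ _ xW)[s [ps us aA ->]].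
  apply/reachP => //; exists s; split => //; apply: (sub_all _ aA) => z /=.
  by apply: contra; rewrite !inE => /predU1P[zE|->//]; move: tW; rewrite -zE inE.
apply/subsetP => u; rewrite inE => /andP[uY /exists_inP[y yY yu]].
have : u \in C :|: W by apply/negPn; apply: contra uY; apply: reach_step yu.
rewrite inE; case/orP => // uC.
have yK : y \in comp.
  case/(reachP _ _ xW): yY => s [ps us aA ->]; apply/reachP => //; exists s; split => //.
  by apply: (sub_all _ aA) => z; rewrite /= inE negb_or => /andP[].
have uP : u \in attach by apply/attachP; split => //; exists y.
have guW : gate u \in W by apply: imset_f.
case: (gateP u) guW => // t dt _ tW; have [_ _ xt /(_ y)] := domP dt.
by rewrite yu (subsetP (YK _ _ xt)) // ?inE ?tW ?orbT // => /(_ isT).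
Qed.
End Links.

(** * Rerouting a cycle *)

Section Surgery.
Context (V : finType) (e : rel V) (e_sym : symmetric e).
Implicit Types (s l m O M J : seq V).

Lemma path_join a A b B : path e a (rcons A b ++ B) = path e a (rcons A b) && path e b B.
Proof. by rewrite cat_path last_rcons. Qed.

Lemma path_back a A b : path e a (rcons A b) -> path e b (rcons (rev A) a).
Proof.
have := rev_path e a (rcons A b); rewrite last_rcons belast_rcons rev_cons => E h.
by rewrite E (eq_path (e' := e)) // => y z; rewrite e_sym.
Qed.

Lemma skip_arc s p O p' J l n : rot n s = p :: O ++ p' :: J -> uniq s -> cycle e s ->
    path e p (rcons l p') -> uniq l -> {in l, forall z, z \notin s} ->
  [/\ uniq (p :: l ++ p' :: J), cycle e (p :: l ++ p' :: J) &
     forall z, (z \in p :: l ++ p' :: J) = (z \in l) || ((z \in s) && (z \notin O))].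
Proof.
move=> sE us cs pl ul dl.
have us' : uniq (p :: O ++ p' :: J) by rewrite -sE rot_uniq.
have ms z : (z \in s) = (z \in p :: O ++ p' :: J) by rewrite -sE mem_rot.
have cs' : cycle e (p :: O ++ p' :: J) by rewrite -sE rot_cycle.
have nl z : z \in p :: O ++ p' :: J -> z \notin l.
  by rewrite -ms => zs; apply: contraTN zs => /dl.
split.
- have sub : subseq (p :: p' :: J) (p :: O ++ p' :: J).
    by rewrite /= eqxx; apply: suffix_subseq.
  have u2 := subseq_uniq sub us'.
  have : uniq ((p :: p' :: J) ++ l).
    rewrite cat_uniq u2 ul andbT; apply/hasPn => z zl; apply: contraTN zl => zp.
    by apply: nl; apply: (mem_subseq sub).
  rewrite (perm_uniq (s2 := p :: l ++ p' :: J)) //.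
  by rewrite perm_cons perm_sym; apply/permPl; apply: perm_catC.
- move: cs'; rewrite /cycle rcons_cat rcons_cons -cat_rcons path_join => /andP[_ pJ].
  by rewrite rcons_cat rcons_cons -cat_rcons path_join pl.
- move=> z; rewrite ms; move: us'; rewrite cons_uniq mem_cat cat_uniq.
  move=> /andP[/norP[pO pJ] /and3P[_ /hasPn hO _]].
  rewrite !inE !mem_cat !inE; case: (z =P p) => [->|_] /=; first by rewrite pO !orbT.
  case: (boolP (z \in l)) => //= zl; case: (boolP (z \in O)) => /= [zO|]; last by rewrite andbT.
  by apply: contraTF zO => zJ; apply: hO; rewrite inE.
Qed.

(** The arcs [O] after [p] and [O'] after [q] are dropped. The new cycle runs from [u] to [q],
    through [l] to [p], backwards along the other kept arc to [u'], and through [m] back to [u]. *)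
Lemma cross_arcs s p O u M q O' u' M' l m n :
    rot n s = p :: O ++ u :: M ++ q :: O' ++ u' :: M' -> uniq s -> cycle e s ->
    path e q (rcons l p) -> path e u' (rcons m u) -> uniq (l ++ m) ->
    {in l ++ m, forall z, z \notin s} ->
  let s' := u :: M ++ q :: l ++ p :: rev (u' :: M') ++ m in
  [/\ uniq s', cycle e s' & forall z, (z \in s') =
     [|| z \in l, z \in m | [&& z \in s, z \notin O & z \notin O']]].
Proof.
move=> sE us cs pl pm ulm dlm s'.
set t := p :: O ++ u :: M ++ q :: O' ++ u' :: M' in sE.
have ut : uniq t by rewrite -sE rot_uniq.
have ms z : (z \in s) = (z \in t) by rewrite -sE mem_rot.
have ct : cycle e t by rewrite -sE rot_cycle.
pose k := p :: u :: M ++ q :: u' :: M'.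
have pt : perm_eq t (k ++ (O ++ O')).
  by apply/permP => a; rewrite /t /k /= !count_cat /= !count_cat /= !count_cat /=; clear; lia.
have ps' : perm_eq s' (k ++ (l ++ m)).
  apply/permP => a; rewrite /s' /k rev_cons -cats1 /= !count_cat /= !count_cat /=.
  by rewrite !count_cat /= count_rev; clear; lia.
have : uniq (k ++ (O ++ O')) by rewrite -(perm_uniq pt).
rewrite cat_uniq => /and3P[uk /hasPn kO _].
split.
- rewrite (perm_uniq ps') cat_uniq uk ulm andbT; apply/hasPn => z zlm.
  by apply: contra (dlm z zlm) => zk; rewrite ms (perm_mem pt) mem_cat zk.
- move: ct; rewrite /t /s' /cycle rcons_cat rcons_cons -cat_rcons path_join => /andP[_].
  rewrite rcons_cat rcons_cons -cat_rcons path_join => /andP[pM].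
  rewrite rcons_cat rcons_cons -cat_rcons path_join => /andP[_ pM'].
  rewrite rcons_cat rcons_cons -cat_rcons path_join pM /=.
  rewrite rcons_cat rcons_cons -cat_rcons path_join pl /=.
  by rewrite rev_cons rcons_cat path_join (path_back pM').
- move=> z; rewrite (perm_mem ps') ms (perm_mem pt) !(mem_cat z k) !(mem_cat z l).
  rewrite !(mem_cat z O); case: (boolP (z \in l)) => [_|zl]; first by rewrite !orbT.
  case: (boolP (z \in m)) => [_|zm]; first by rewrite !orbT.
  rewrite /= !orbF; case: (boolP (z \in k)) => zk /=.
    apply/esym; rewrite -negb_or -mem_cat; apply/negP => zO.
    by have := kO z zO; rewrite /= zk.
  by case: (z \in O); case: (z \in O').
Qed.
End Surgery.

(** * The arcs of a cycle between consecutive marked vertices *)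

Section Gaps.
Context (V : finType) (s : seq V) (us : uniq s) (P : {set V}) (Ps : {subset P <= s}).
Implicit Types (p q : V).

Definition after p := behead (rot (index p s) s).
Definition gap p := take (find (mem P) (after p)) (after p).
(** The default [p] is returned when no other vertex of [P] lies on the cycle. *)
Definition nxt p := nth p (after p) (find (mem P) (after p)).

Lemma rot_after p : p \in s -> rot (index p s) s = p :: after p.
Proof. by move=> ps; rewrite /after /rot drop_index. Qed.

Lemma afterE n p t : rot n s = p :: t -> after p = t.
Proof.
move=> sE; have [nlt|nge] := ltnP n (size s); last first.
  by move: sE; rewrite rot_oversize // => sE; rewrite /after sE /= eqxx rot0.
have pE : nth p s n = p.
  by have := congr1 (head p) sE; rewrite /rot (drop_nth p nlt).
by rewrite /after -{1}pE index_uniq // sE.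
Qed.

Lemma gap_nxt p : has (mem P) (after p) ->
  [/\ exists J, after p = gap p ++ nxt p :: J, nxt p \in P &
      forall z, z \in gap p -> z \notin P].
Proof.
move=> hP; split.
- exists (drop (find (mem P) (after p)).+1 (after p)).
  by rewrite -drop_nth ?cat_take_drop // -has_find.
- exact: nth_find.
- move=> z zg; have lt : index z (gap p) < find (mem P) (after p).
    apply: leq_trans (_ : size (gap p) <= _); first by rewrite index_mem.
    by rewrite /gap size_take; case: ltnP.
  by have /negbT := before_find z lt; rewrite /= -(nth_take _ lt) nth_index.
Qed.

Lemma has_after p q : p \in P -> q \in P -> p != q -> has (mem P) (after p).
Proof.
move=> pP qP pq; apply/hasP; exists q => //.
have : q \in rot (index p s) s by rewrite mem_rot Ps.
by rewrite rot_after ?Ps // inE eq_sym (negbTE pq).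
Qed.

Lemma take_find_cat (T : Type) (a : pred T) (t t' : seq T) y : a y ->
  exists t2, t = take (find a (t ++ y :: t')) (t ++ y :: t') ++ t2.
Proof.
move=> ay; rewrite find_cat; case: ifP => h.
  by exists (drop (find a t) t); rewrite takel_cat ?find_size // cat_take_drop.
by exists [::]; rewrite /= ay addn0 take_size_cat // cats0.
Qed.

Lemma gap_pair p q : p \in P -> q \in P -> p != q ->
  exists J1 J2, rot (index p s) s = p :: gap p ++ J1 ++ q :: gap q ++ J2.
Proof.
move=> pP qP pq; have sE := rot_after (Ps pP).
have [[J aE] _ gP] := gap_nxt (has_after pP qP pq).
have qa : q \in nxt p :: J.
  have : q \in rot (index p s) s by rewrite mem_rot Ps.
  rewrite sE aE inE eq_sym (negbTE pq) /=.
  by rewrite mem_cat => /orP[/gP|//]; rewrite qP.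
case/splitPr: {1}(nxt p :: J) / qa (erefl (nxt p :: J)) => J1 J3 JE.
exists J1; suff [J2 J3E] : exists J2, J3 = gap q ++ J2 by exists J2; rewrite sE aE -JE J3E.
have sq : rot (rot_add s (index p s) (size (p :: gap p ++ J1))) s = q :: (J3 ++ p :: gap p ++ J1).
  rewrite -rot_rot_add sE aE -JE -[q :: J3 ++ _]/((q :: J3) ++ (p :: gap p ++ J1)).
  by rewrite -[RHS]rot_size_cat /= -catA.
have [J2 ?] := @take_find_cat _ (mem P) J3 (gap p ++ J1) p pP.
by exists J2; rewrite /gap (afterE sq).
Qed.

Lemma gap_disjoint p q z : p \in P -> q \in P -> p != q -> z \in gap p -> z \notin gap q.
Proof.
move=> pP qP pq zp; have [J1 [J2 sE]] := gap_pair pP qP pq.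
have : uniq (p :: gap p ++ J1 ++ q :: gap q ++ J2) by rewrite -sE rot_uniq.
rewrite /= cat_uniq => /andP[_ /and3P[_ /hasPn h _]].
apply: contraL zp => zq; apply: h; by rewrite mem_cat inE mem_cat zq !orbT.
Qed.

Lemma gap_sub p : p \in P -> {subset gap p <= s}.
Proof.
move=> pP z /mem_take zp; rewrite -(mem_rot (index p s)) rot_after ?Ps //.
by rewrite inE zp orbT.
Qed.

(** Going round the cycle from [q], the last vertex of the class of [p] is followed in [P] by a
    vertex of another class. *)
Lemma class_end (w : V -> V) p q : p \in P -> q \in P -> w q != w p ->
  exists2 p', p' \in P & (w p' == w p) && (w (nxt p') != w p).
Proof.
move=> pP qP wqp; have sE := rot_after (Ps qP).
pose a z := (z \in P) && (w z == w p).
have pq : p != q by apply: contraNneq wqp => ->.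
have ha : has a (after q).
  apply/hasP; exists p; last by rewrite /a pP eqxx.
  have : p \in rot (index q s) s by rewrite mem_rot Ps.
  by rewrite sE inE (negbTE pq).
have [t1 [p' [t2 [aE /andP[p'P wp'] nt2]]]] : exists t1 p' t2,
    [/\ after q = t1 ++ p' :: t2, a p' & ~~ has a t2].
  elim: (after q) ha => // y t IH /=; case: (boolP (has a t)) => [/IH h _|nh].
    by case: h => t1 [p' [t2 [-> ? ?]]]; exists (y :: t1), p', t2.
  by rewrite orbF => ay; exists [::], y, t.
exists p'; rewrite // wp' /=.
have sp : rot (rot_add s (index q s) (size (q :: t1))) s = p' :: (t2 ++ q :: t1).
  by rewrite -rot_rot_add sE aE -[RHS]/((p' :: t2) ++ (q :: t1)) -[RHS]rot_size_cat.
have p'q : p' != q by apply: contraTneq wp' => ->.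
have [[J a'E] nP gP] := gap_nxt (has_after p'P qP p'q).
rewrite (afterE sp) in a'E.
have [nt|nt] := boolP (nxt p' \in t2).
  by move/hasPn: nt2 => /(_ _ nt); rewrite /a nP.
suff -> : nxt p' = q by [].
have h2 : ~~ has (mem P) t2.
  apply/hasPn => z zt; apply/negP => zP.
  have : find (mem P) (t2 ++ q :: t1) < size t2.
    have ht2 : has (mem P) t2 by apply/hasP; exists z.
    by rewrite find_cat ht2 -has_find.
  move=> lt; move: nt; rewrite /nxt (afterE sp) nth_cat lt.
  by rewrite mem_nth.
by rewrite /nxt (afterE sp) find_cat (negbTE h2) /= qP addn0 nth_cat ltnn subnn.
Qed.
End Gaps.

(** * Connections through the outside of a cycle *)

Section Outside.
Context (V : finType) (e : rel V) (e_sym : symmetric e) (e_irr : irreflexive e).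
Context (C H : {set V}).
Implicit Types (O : {set V}) (u v d : V).

Definition out u :=
  [set d | [exists d0, [&& d0 \notin C, e u d0 & connect (avoid e C) d0 d]]].
Definition conn u v := e u v || [exists d in out u, e d v].
(** The stability number of what is uncovered in [H] once the part [O] of the cycle [C] is given
    up. *)
Definition mu O := alpha e (H :&: (~: C :|: O)).

Lemma avoid_sym : connect_sym (avoid e C).
Proof. by apply: sym_connect_sym => a b; rewrite /avoid e_sym andbCA andbC andbA. Qed.

Lemma connect_avoid a b : connect (avoid e C) a b -> a \notin C -> b \notin C.
Proof.
case/connectP => p pp -> aC; elim: p a pp aC => //= b' p IH a /andP[/and3P[_ _ b'C] pp] _.
exact: IH pp b'C.
Qed.

Lemma out_notin u d : d \in out u -> d \notin C.
Proof. by rewrite inE => /existsP[d0 /and3P[d0C _ /connect_avoid]]; apply. Qed.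

Lemma out_step u d d' : d \in out u -> e d d' -> d' \notin C -> d' \in out u.
Proof.
move=> du dd' d'C; have dC := out_notin du.
move: du; rewrite !inE => /existsP[d0 /and3P[d0C ud0 cd]].
apply/existsP; exists d0; rewrite d0C ud0; apply: connect_trans cd (connect1 _).
by rewrite /avoid dd' dC.
Qed.

Lemma out_nbr u d : e u d -> d \notin C -> d \in out u.
Proof. by move=> ud dC; rewrite inE; apply/existsP; exists d; rewrite dC ud connect0. Qed.

Lemma conn_path u v : u \in C -> v \in C -> conn u v -> exists m,
  [/\ path e u (rcons m v), uniq m, {subset m <= out u} & {in m, forall z, z \notin C}].
Proof.
move=> uC vC /orP[uv|/exists_inP[d]]; first by exists [::]; rewrite /= uv.
rewrite inE => /existsP[d0 /and3P[d0C ud0 /connectP[p pp dE]]].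
case: (shortenP pp) dE => p' pp' up' _ dE dv; exists (d0 :: p').
have sub : {subset d0 :: p' <= out u}.
  have h0 : d0 \in out u by apply: out_nbr.
  move=> z; rewrite inE => /predU1P[->//|].
  elim: p' d0 h0 {ud0 pp d0C dE up'} pp' => //= b p' IH a ha /andP[/and3P[ab aC bC] pb].
  have hb := out_step ha ab bC.
  by rewrite inE => /predU1P[->//|]; apply: (IH b).
split => //.
  rewrite rcons_cons /= ud0 rcons_path -dE dv andbT.
  by apply: sub_path pp' => a b /and3P[].
by move=> z /sub; apply: out_notin.
Qed.

(** This keeps the two detours of [cross_arcs] disjoint: one stays in the component of [x], the
    other in outside components adjacent to [u]. *)
Lemma out_comp x u z : x \notin C -> u \in C -> u \notin attach e C x ->
  z \in out u -> z \notin comp e C x.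
Proof.
move=> xC uC uP; rewrite inE => /existsP[d0 /and3P[d0C ud0 cd]]; apply/negP => zK.
apply: (negP uP); apply/attachP; split => //; exists d0; last by rewrite e_sym.
by move: zK; rewrite !inE => h; apply: connect_trans h _; rewrite avoid_sym.
Qed.

(** The components outside [C] that touch [O], together with [O], send no edge to the other
    components and [O'], so [alpha_modular] applies. *)
Lemma mu_modular O O' : O \subset C -> O' \subset C -> [disjoint O & O'] ->
    {in O & O', forall u v, ~~ conn u v} ->
  mu (O :|: O') + mu set0 = mu O + mu O'.
Proof.
move=> OC O'C dOO' nc.
pose X := \bigcup_(u in O) out u; pose D := H :\: C.
have XC z : z \in X -> z \notin C by case/bigcupP => u _ /out_notin.
have dC z : z \in D -> z \notin C by rewrite inE => /andP[].
have DE : (D :&: X) :|: (D :\: X) = D by rewrite setID.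
have muE O1 : O1 \subset C -> H :&: (~: C :|: O1) = D :|: (H :&: O1).
  by move=> _; rewrite setIUr -setDE.
rewrite /mu !muE ?sub0set ?subUset ?OC // setI0 setU0 setIUr.
have := alpha_modular e_sym (D1 := D :&: X) (D2 := D :\: X) (O1 := H :&: O) (O2 := H :&: O').
have -> : (D :&: X) :|: (H :&: O) :|: ((D :\: X) :|: (H :&: O')) =
    D :|: (H :&: O :|: H :&: O').
  by rewrite -{3}DE !setUA; congr (_ :|: _); rewrite -!setUA; congr (_ :|: _); rewrite setUC.
have -> : (D :&: X) :|: (H :&: O) :|: (D :\: X) = D :|: (H :&: O).
  by rewrite -{3}DE -!setUA; congr (_ :|: _); rewrite setUC.
have -> : (D :&: X) :|: ((D :\: X) :|: (H :&: O')) = D :|: (H :&: O').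
  by rewrite setUA DE.
rewrite DE; apply.
  apply/pred0P => z /=; apply/negP => /andP[]; rewrite !inE.
  case/orP => [/andP[/andP[zC _] zX]|/andP[_ zO]].
    by rewrite zX /= => /andP[_ /(subsetP O'C)]; rewrite (negbTE zC).
  rewrite (disjointFr dOO' zO) !andbF orbF => /and3P[_ zC _].
  by rewrite (subsetP OC) in zC.
move=> a b; rewrite !inE => /orP[/andP[/andP[aC _] aX]|/andP[_ aO]].
  case/orP => [/and3P[bX bC _]|/andP[_ bO]]; apply/negP => ab.
    case/bigcupP: aX => u uO ua; move: bX; apply/negP; rewrite negbK.
    by apply/bigcupP; exists u => //; apply: out_step ab bC.
  case/bigcupP: aX => u uO ua; move: (nc _ _ uO bO); rewrite /conn negb_or.
  by case/andP => _ /exists_inPn /(_ _ ua); rewrite ab.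
case/orP => [/and3P[bX bC _]|/andP[_ bO]]; last first.
  by move: (nc _ _ aO bO); rewrite /conn negb_or => /andP[].
apply: contra bX => ab; apply/bigcupP; exists a => //; exact: out_nbr.
Qed.

End Outside.

(** * Enlarging a cycle by one vertex *)

Section Step.
Context (V : finType) (e : rel V) (e_sym : symmetric e) (e_irr : irreflexive e).

Lemma sum_gt a r c d t : a + r = c + d -> r < c -> r + t <= d -> r + t.+1 <= a.
Proof. lia. Qed.

Lemma sum_contra a r b d o g h :
  a + r = b + d -> r < b -> r + o <= d -> g <= o -> h <= r + g -> a <= h -> False.
Proof. lia. Qed.

Lemma rising_prefix (f : {set V} -> nat) r (t : seq V) : r < f [set z in t] ->
    f set0 <= r ->
  exists n, r < f [set z in take n t] /\
    forall A1 u A2, take n t = A1 ++ u :: A2 -> f [set z in A1] <= r.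
Proof.
move=> ft f0; have ex : exists n, r < f [set z in take n t].
  by exists (size t); rewrite take_size.
case: (ex_minnP ex) => n rn nmin; exists n; split => // A1 u A2 tE.
rewrite leqNgt; apply/negP => h.
have lt : size A1 < n.
  by have := congr1 size tE; rewrite size_take size_cat /=; case: ltnP; lia.
have A1E : A1 = take (size A1) t.
  by rewrite -(take_takel _ (ltnW lt)) tE take_size_cat.
by have := nmin (size A1); rewrite -A1E h leqNgt lt => /(_ isT).
Qed.

Lemma first_has (T : eqType) (a : pred T) (t : seq T) : has a t ->
  exists A1 u A2, [/\ t = A1 ++ u :: A2, a u & ~~ has a A1].
Proof.
elim: t => //= y t IH; case: (boolP (a y)) => [ay _|ay /IH]; first by exists [::], y, t.
by case=> A1 [u [A2 [-> h1 h2]]]; exists (y :: A1), u, A2; rewrite /= negb_or ay.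
Qed.

(* Two shortest prefixes of gaps that raise the stability number of the uncovered
   part are either joined through the outside of the cycle, and then one detour
   skips both and visits [x], or all such prefixes are pairwise unrelated and
   their increments add up. *)
Lemma cycle_step (s : seq V) x (Y0 H : {set V}) g :
    uniq s -> cycle e s -> x \notin s -> {subset Y0 <= s} -> #|Y0| <= 1 ->
    let C := [set z in s] in let W := gate e C x @: attach e C x in
    1 < #|W| -> g + #|Y0| <= #|W| -> alpha e (x |: H) <= alpha e (H :\: C) + g ->
  exists s', [/\ uniq s', cycle e s', {subset Y0 <= s'} &
    alpha e ((x |: H) :\: [set z in s']) <= alpha e (H :\: C)].
Proof.
move=> us cs xs Ys Y1 C W W2 gW aH; set r := alpha e (H :\: C).
have [small|big] := leqP (alpha e ((x |: H) :\: C)) r; first by exists s.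
pose P := attach e C x; pose w := gate e C x.
have xC : x \notin C by rewrite inE.
have Ps : {subset P <= s} by move=> p /attachP[]; rewrite inE.
pose m := mu e C H.
have m0 : m set0 = r by rewrite /m /mu setU0 -setDE.
(* If the next attachment has another gate, [link] gives a detour through [x] around the whole gap
   of [p]. [class_end] yields such a [p] for every gate, and [f] chooses one. *)
pose gd p := (p \in P) && (w (nxt s P p) != w p).
pose f o := odflt x [pick p | gd p && (w p == o)].
have fP o : o \in W -> gd (f o) /\ w (f o) = o.
  case/imsetP => p pP ->.
  have [q qP wqp] : exists2 q, q \in P & w q != w p.
    apply/exists_inP; apply: contraLR W2 => /exists_inPn h; rewrite -leqNgt.
    rewrite -(cards1 (w p)); apply: subset_leq_card; apply/subsetP => _ /imsetP[q qP ->].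
    by rewrite inE; have := h q qP; rewrite negbK.
  have [p' p'P /andP[wp' np']] := class_end us Ps pP qP wqp.
  rewrite /f; case: pickP => [q' /andP[gq /eqP //]|/(_ p')].
  by rewrite /gd p'P (eqP wp') np' eqxx.
pose Om := f @: W.
have OmP p : p \in Om -> gd p /\ p = f (w p).
  by case/imsetP => o oW ->; have [h1 h2] := fP o oW; split=> //; rewrite h2.
have cOm : #|Om| = #|W|.
  by apply: card_in_imset => o o' oW o'W ff; rewrite -(fP o oW).2 ff (fP o' o'W).2.
have OmPP p : p \in Om -> p \in P by case/OmP => /andP[].
have Omw p q : p \in Om -> q \in Om -> p != q -> w p != w q.
  by move=> /OmP[_ pE] /OmP[_ qE]; apply: contraNneq => h; rewrite pE qE h.
(* A gap holding the vertex of [Y0] must not be dropped. Gaps are disjoint, so at most one is lost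
   and [g] remain. *)
pose Om' := [set p in Om | ~~ has (mem Y0) (gap s P p)].
have gOm : g <= #|Om'|.
  have : #|Om| <= #|Om'| + #|Y0|.
    have [p0 /andP[p0O /hasP[y yg yY]]|h] :=
        pickP [pred p | (p \in Om) && has (mem Y0) (gap s P p)].
      have {}yY : y \in Y0 by [].
      have Y0E : Y0 = [set y].
        by apply/eqP; rewrite eq_sym eqEcard sub1set yY cards1.
      have sub : Om \subset p0 |: Om'.
        apply/subsetP => p pO; rewrite in_setU1; have [//|pp0 /=] := eqVneq p p0.
        rewrite inE pO /=.
        apply/hasPn => z zp; rewrite /= Y0E inE; apply: contraTneq zp => ->.
        by apply: (gap_disjoint us Ps (OmPP _ p0O) (OmPP _ pO)); rewrite // eq_sym.
      rewrite addnC Y0E cards1; apply: leq_trans (subset_leq_card sub) _.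
      by rewrite cardsU1 leq_add2r; case: (_ \notin _).
    apply: leq_trans (_ : #|Om'| <= _); last exact: leq_addr.
    apply: subset_leq_card; apply/subsetP => p pO; rewrite inE pO /=.
    by have := h p; rewrite /= pO /= => ->.
  by rewrite cOm => h; have := leq_trans gW h; rewrite leq_add2r.
have Om'O p : p \in Om' -> p \in Om by rewrite inE => /andP[].
have hasA p : p \in Om -> has (mem P) (after s p).
  move=> pO; have /set0Pn[q] : Om :\ p != set0.
    by rewrite -card_gt0; move: W2; rewrite -cOm (cardsD1 p) pO.
  by rewrite !inE => /andP[qp qO]; apply: (has_after Ps (OmPP _ pO) (OmPP _ qO)); rewrite eq_sym.
have gapP p z : p \in Om -> z \in gap s P p -> z \notin P.
  by move=> pO; have [_ _] := gap_nxt (hasA _ pO); apply.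
have gapC p z : p \in Om -> z \in gap s P p -> z \in C.
  by move=> pO /(gap_sub Ps (OmPP _ pO)); rewrite inE.
have keepY p y : p \in Om' -> y \in Y0 -> y \notin gap s P p.
  rewrite inE => /andP[_ /hasPn h] yY; apply/negP => /h; by rewrite /= yY.
(* A gap whose loss does not raise the stability number can be bypassed at once; otherwise it has a
   minimal prefix that raises it. *)
have [/exists_inP[p pO' mp]|] := boolP [exists p in Om', m [set z in gap s P p] <= r].
  have pO := Om'O _ pO'; have [[J aE] nP _] := gap_nxt (hasA _ pO).
  have sE : rot (index p s) s = p :: gap s P p ++ nxt s P p :: J.
    by rewrite rot_after ?aE // Ps // OmPP.
  have [/andP[_ wn] _] := OmP _ pO.
  have [l [pl ul lK xl]] := link e_sym xC (OmPP _ pO) nP ltac:(by rewrite eq_sym).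
  have [|u' c' mem'] := skip_arc sE us cs pl ul.
    by move=> z /lK /(comp_notin xC); rewrite inE.
  exists (p :: l ++ nxt s P p :: J); split => //.
    by move=> y yY; rewrite mem' Ys // keepY // orbT.
  apply: leq_trans mp; apply: alphaS; apply/subsetP => z.
  rewrite in_setD in_setU1 [z \in [set _ in _]]inE mem' negb_or negb_and negbK.
  move=> /andP[/andP[zl zs] /predU1P[zx|zH]]; first by rewrite zx xl in zl.
  by rewrite !inE zH; case/orP: zs => ->; rewrite ?orbT.
move/exists_inPn => rise.
have /fin_all_exists[pn pnP] : forall p, exists n, p \in Om' ->
    r < m [set z in take n (gap s P p)] /\
    forall A1 u A2, take n (gap s P p) = A1 ++ u :: A2 -> m [set z in A1] <= r.
  move=> p; have [pO'|] := boolP (p \in Om'); last by exists 0.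
  have [||n nP] := @rising_prefix m r (gap s P p).
  - by rewrite ltnNge rise.
  - by rewrite m0.
  - by exists n.
pose pre p := take (pn p) (gap s P p).
have preg p z : z \in pre p -> z \in gap s P p by apply: mem_take.
have preC p : p \in Om' -> [set z in pre p] \subset C.
  move=> pO; apply/subsetP => z; rewrite inE => /preg; exact: gapC (Om'O _ pO).
have [/exists_inP[p pO' /exists_inP[q qO' /andP[pq hpq]]]|] :=
    boolP [exists p in Om', exists q in Om', (p != q) &&
      has (fun u => has (conn e C u) (pre q)) (pre p)].
  have pO := Om'O _ pO'; have qO := Om'O _ qO'.
  (* [u] is the first vertex of [pre p] joined to [pre q], and [v] the first of [pre q] joined to
     [u]. So the dropped parts [A1] and [B1] are unrelated, and as proper parts of minimal prefixes
     neither raises [m] above [r]. *)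
  have [A1 [u [A2 [pE hu nA1]]]] := first_has hpq.
  have [B1 [v [B2 [qE uv nB1]]]] := first_has hu.
  have [J1 [J2 sE]] := gap_pair us Ps (OmPP _ pO) (OmPP _ qO) pq.
  have gp : gap s P p = A1 ++ u :: (A2 ++ drop (pn p) (gap s P p)).
    by rewrite -cat_cons catA -pE cat_take_drop.
  have gq : gap s P q = B1 ++ v :: (B2 ++ drop (pn q) (gap s P q)).
    by rewrite -cat_cons catA -qE cat_take_drop.
  have ug : u \in gap s P p by rewrite gp mem_cat mem_head orbT.
  have vg : v \in gap s P q by rewrite gq mem_cat mem_head orbT.
  have [k [pk uk ko kC]] := conn_path (gapC _ _ pO ug) (gapC _ _ qO vg) uv.
  have [l [pl ul lK xl]] := link e_sym xC (OmPP _ qO) (OmPP _ pO)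
    ltac:(by rewrite eq_sym; apply: Omw).
  rewrite {1}gp {1}gq -!catA /= -!catA in sE.
  have sE' : rot (index p s) s = p :: A1 ++ u :: (A2 ++ drop (pn p) (gap s P p) ++ J1) ++
      q :: B1 ++ v :: (B2 ++ drop (pn q) (gap s P q) ++ J2).
    by rewrite sE -!catA.
  have [||u' c' mem'] := cross_arcs e_sym sE' us cs pl (path_back e_sym pk).
  - rewrite cat_uniq ul rev_uniq uk andbT; apply/hasPn => z; rewrite mem_rev => zk /=.
    apply/negP => /lK; apply/negP.
    exact: (out_comp e_sym xC (gapC _ _ pO ug) (gapP _ _ pO ug) (ko z zk)).
  - move=> z; rewrite mem_cat mem_rev => /orP[/lK/(comp_notin xC)|/kC]; by rewrite inE.
  have sA1 z : z \in A1 -> z \in pre p by rewrite pE mem_cat => ->.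
  have sB1 z : z \in B1 -> z \in pre q by rewrite qE mem_cat => ->.
  eexists; split; [exact: u'|exact: c'| |].
    move=> y yY; rewrite mem' Ys //=; apply/or3P/Or33/andP; split.
      by apply: contra (keepY _ _ pO' yY) => /sA1/preg.
    by apply: contra (keepY _ _ qO' yY) => /sB1/preg.
  have le1 : m [set z in A1] <= r by apply: (pnP _ pO').2 pE.
  have le2 : m [set z in B1] <= r by apply: (pnP _ qO').2 qE.
  have := mu_modular e_sym (C := C) H (O := [set z in A1]) (O' := [set z in B1]).
  rewrite -/m m0 => md.
  have {md} le : m ([set z in A1] :|: [set z in B1]) <= r.
    rewrite -(leq_add2r r) md ?leq_add //.
    - by apply: subset_trans (preC _ pO'); apply/subsetP => z; rewrite !inE => /sA1.
    - by apply: subset_trans (preC _ qO'); apply/subsetP => z; rewrite !inE => /sB1.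
    - apply/pred0P => z /=; rewrite !inE; apply/negP => /andP[/sA1/preg zp /sB1/preg zq].
      by have := gap_disjoint us Ps (OmPP _ pO) (OmPP _ qO) pq zp; rewrite zq.
    - move=> a b; rewrite !inE => aA bB; apply/negP => ab.
      by move/hasPn: nA1 => /(_ a aA)/hasPn /(_ b (sB1 _ bB)); rewrite ab.
  apply: leq_trans le; apply: alphaS; apply/subsetP => z.
  rewrite in_setD inE mem' !negb_or => /andP[/and3P[zl _]].
  rewrite !negb_and !negbK => zs /setU1P[zx|zH]; first by rewrite zx xl in zl.
  by rewrite !inE zH /=; case/or3P: zs => ->; rewrite ?orbT.
move/exists_inPn => nconn.
pose U (t : seq V) := \bigcup_(p <- t) [set z in pre p].
have grow t : uniq t -> {subset t <= Om'} -> r + size t <= m (U t) /\ U t \subset C.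
  elim: t => [|p t IH] /=; first by rewrite /U big_nil m0 addn0 sub0set.
  case/andP => pt ut sO; have pO' : p \in Om' by apply: sO; exact: mem_head.
  have [|h1 h2] := IH ut; first by move=> z zt; apply: sO; rewrite inE zt orbT.
  rewrite /U big_cons -/(U t) subUset h2 preC //; split => //.
  have [h3 _] := pnP _ pO'.
  suff : m ([set z in pre p] :|: U t) + m set0 = m [set z in pre p] + m (U t).
    by rewrite m0 => E; exact: (sum_gt E h3 h1).
  have inU z : z \in U t -> exists q, [/\ q \in Om', q != p & z \in pre q].
    rewrite /U; elim: (t) pt sO {h1 h2 IH ut} => [|q t' IH]; first by rewrite big_nil inE.
    rewrite big_cons !inE negb_or => /andP[pq pt] sO /orP[zq|].
      by exists q; split; rewrite // 1?eq_sym //; apply: sO; rewrite !inE eqxx orbT.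
    by apply: IH => // z'; rewrite inE => /orP[z'p|z't]; apply: sO; rewrite !inE ?z'p ?z't ?orbT.
  apply: mu_modular => //; first exact: preC.
    apply/pred0P => z /=; rewrite inE; apply/negP => /andP[/preg zp /inU[q [qO' qp /preg zq]]].
    by have := gap_disjoint us Ps (OmPP _ (Om'O _ qO')) (OmPP _ (Om'O _ pO')) qp zq; rewrite zp.
  move=> a b; rewrite inE => ap /inU[q [qO' qp bq]]; apply/negP => ab.
  have := nconn p pO'; move/exists_inPn => /(_ q qO'); rewrite eq_sym qp /=.
  by move/hasPn => /(_ a ap) /hasPn /(_ b bq); rewrite ab.
have [gU UC] := grow (enum Om') (enum_uniq _) ltac:(by move=> z; rewrite mem_enum).
set U1 := U _ in gU UC; rewrite -cardE in gU.
have UP z : z \in U1 -> z \notin P.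
  rewrite /U1 /U big_enum => /bigcupP[p pO']; rewrite inE => /preg; exact: gapP (Om'O _ pO').
(* By [big], [x] gains at least one over [r], inside its own component. No vertex of [U1] is an
   attachment, so this gain adds to the gain [g] of [U1], against the bound on
   [alpha e (x |: H)]. *)
exfalso; pose K := comp e C x; pose D := H :\: C.
have xK : x \in K by apply: comp_root.
have DK : (D :&: K) :|: (D :\: K) = D by rewrite setID.
have := @alpha_modular _ e e_sym (D :&: K) (D :\: K) [set x] (H :&: U1).
have -> : (D :&: K) :|: [set x] :|: (D :\: K) = (x |: H) :\: C.
  rewrite -setUA setUCA DK setDUl; congr (_ :|: _).
  by apply/esym/setDidPl; rewrite disjoints1.
have -> : (D :&: K) :|: ((D :\: K) :|: (H :&: U1)) = H :&: (~: C :|: U1).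
  by rewrite setUA DK setIUr -setDE.
rewrite DK -/r => md.
have le : alpha e ((D :&: K :|: [set x]) :|: (D :\: K :|: H :&: U1)) <= alpha e (x |: H).
  apply: alphaS; apply/subsetP => z; rewrite !inE.
  by case: (z \in H); rewrite ?orbT // !andbF /= orbF.
suff : alpha e ((D :&: K :|: [set x]) :|: (D :\: K :|: H :&: U1)) + r =
    alpha e ((x |: H) :\: C) + alpha e (H :&: (~: C :|: U1)).
  by move=> E; exact: (sum_contra E big gU gOm aH le).
have KC z : z \in K -> z \notin C by apply: comp_notin.
apply: md.
  apply/pred0P => z /=; apply/negP => /andP[]; rewrite in_setU in_setI in_set1 => zK.
  have {}zK : z \in K by case/orP: zK => [/andP[]//|/eqP->].
  rewrite in_setU in_setD zK /= in_setI => /andP[_ /(subsetP UC)].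
  by rewrite (negbTE (KC _ zK)).
move=> a b aK bK; have {}aK : a \in K.
  by move: aK; rewrite in_setU in_setI in_set1 => /orP[/andP[]//|/eqP->].
apply/negP => ab; move: bK; rewrite in_setU in_setD in_setI => /orP[/andP[bK]|/andP[_ bU]].
  rewrite in_setD => /andP[bC _]; move/negP: bK; apply.
  exact: (reach_step xC aK ab bC).
apply: (negP (UP _ bU)); apply/attachP; split; first exact: (subsetP UC).
by exists a.
Qed.
End Step.

Ltac arith :=
  repeat match goal with
  | H : is_true (leq _ _) |- _ => revert H
  | H : @eq nat _ _ |- _ => revert H
  end;
  repeat match goal with
  | |- context [alpha ?e ?S] => generalize (alpha e S)
  | |- context [#|?A|] => generalize #|A|
  end;
  clear; intros; lia.

(** * Covering by highly connected cycles *)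

Section Kouider.
Context (V : finType) (e : rel V) (e_sym : symmetric e) (e_irr : irreflexive e).
Implicit Types (C Q T H F Y : {set V}) (k : nat).

Definition clique Q := {in Q &, forall a b, a != b -> e a b}.

(** Connectivity to [Q] in its dual form, in terms of separators not containing [v]; for [v] in [Q]
    the condition is vacuous. *)
Definition far Q k v := forall Y, v \in Y -> [disjoint Y & Q] -> k <= #|bd e Y|.

Lemma alpha_clique Q : clique Q -> alpha e Q <= 1.
Proof.
move=> cQ; have [I /stableP sI [/subsetP IQ <-]] := alpha_ex e Q.
apply/card_le1_eqP => a b aI bI; apply/eqP/negPn/negP => ab.
by have := sI a b aI bI; rewrite e_sym cQ ?IQ.
Qed.

Lemma clique_path x (s : seq V) : uniq (x :: s) ->
  {in x :: s &, forall a b, a != b -> e a b} -> path e x s.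
Proof.
elim: s x => //= y s IH x /andP[]; rewrite inE negb_or => /andP[xy xs] ys h.
rewrite h ?inE ?eqxx ?orbT //=; apply: IH => // a b aS bS.
by apply: h; rewrite inE ?aS ?bS orbT.
Qed.

Lemma clique_cycle (s : seq V) : uniq s -> 1 < size s ->
  {in s &, forall a b, a != b -> e a b} -> cycle e s.
Proof.
case: s => // x s; rewrite /cycle rcons_path => us sz h; rewrite clique_path //=.
case: s us sz h => // y s us _ h; have l : last x (y :: s) \in y :: s by apply: (mem_last y s).
apply: h; rewrite ?mem_head // 1?in_cons ?l ?orbT //.
by move: us => /andP[xs _]; apply: contraNneq xs => <-.
Qed.

Lemma bd_clique Q Y q : clique Q -> q \in Q -> q \in Y -> Q \subset Y :|: bd e Y.
Proof.
move=> cQ qQ qY; apply/subsetP => u uQ; rewrite !inE.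
case: (boolP (u \in Y)) => //= uY; apply/exists_inP; exists q => //.
by apply: cQ => //; apply: contraNneq uY => <-.
Qed.

Lemma gates_far_sub C x Q k : x \notin C -> far Q k x -> Q \subset C ->
  k <= #|gate e C x @: attach e C x|.
Proof.
move=> xC fx QC; have [xY YC bY] := gate_bd e xC.
apply: leq_trans (subset_leq_card bY); apply: fx => //.
by apply: disjointWr YC.
Qed.

Lemma gates_far C x Q k : clique Q -> x \notin C -> far Q k x ->
  k <= #|gate e C x @: attach e C x| \/
  forall u, u \in C -> far Q k u -> u \in gate e C x @: attach e C x.
Proof.
move=> cQ xC fx; have [xY YC bY] := gate_bd e xC; set Y := reach _ _ _ in xY YC bY.
have [W_k|W_k] := leqP k #|gate e C x @: attach e C x|; [by left | right => u uC fu].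
apply/negPn/negP => uW; move: W_k; rewrite ltnNge => /negP; apply.
apply: leq_trans (subset_leq_card bY).
have [dYQ|/pred0Pn[q /andP[/= qY qQ]]] := boolP [disjoint Y & Q]; first exact: fx.
have QY := bd_clique cQ qQ qY.
have uY : u \notin Y by rewrite (disjointFl YC).
have ub : u \notin bd e Y by apply: contra uW => /(subsetP bY).
apply: leq_trans (fu (~: (Y :|: bd e Y)) _ _) _.
- by rewrite in_setC in_setU negb_or uY.
- by rewrite disjoint_sym disjoints_subset setCK.
apply/subset_leq_card/subsetP => z; rewrite inE in_setC negbK => /andP[zY /exists_inP[v vZ vz]].
move: zY; rewrite in_setU => /orP[zY|//].
move: vZ; rewrite in_setC in_setU negb_or => /andP[vY /negP[]].
by rewrite inE vY; apply/exists_inP; exists z; rewrite // e_sym.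
Qed.

Lemma base_cycle Q Y0 : clique Q -> 1 < #|Q| -> #|Y0| <= 1 -> [disjoint Y0 & Q] ->
    {in Y0, forall y, far Q 2 y} ->
  exists s, [/\ uniq s, cycle e s, {subset Y0 <= s} & {subset Q <= s}].
Proof.
move=> cQ Q1 Y1 dYQ fY.
have mQ z : z \in enum Q -> z \in Q by rewrite mem_enum.
have cyc s : uniq s -> 1 < size s -> {subset s <= Q} -> cycle e s.
  by move=> us sz sQ; apply: clique_cycle => // a b /sQ aQ /sQ bQ; apply: cQ.
have [->|[y yY]] := set_0Vmem Y0.
  exists (enum Q); split; rewrite ?enum_uniq //.
  - by apply: cyc; rewrite ?enum_uniq -?cardE.
  - by move=> z; rewrite inE.
  - by move=> z; rewrite mem_enum.
have yQ : y \notin Q by rewrite (disjointFr dYQ).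
have /card_gt1P[_ [_ [/imsetP[p pP ->] /imsetP[q qP ->] gpq]]] :=
  gates_far_sub yQ (fY y yY) (subxx Q).
have [l [pl ul lK yl]] := link e_sym yQ pP qP gpq.
have pQ : p \in Q by case/attachP: pP.
have qQ : q \in Q by case/attachP: qP.
have pq : p != q by apply: contraNneq gpq => ->.
(* With [p] and [q] consecutive, the arc between them is empty, and replacing it by [l] only adds
   [y]. *)
pose s := p :: q :: enum (Q :\: [set p; q]).
have us : uniq s by rewrite /= enum_uniq inE (negbTE pq) !mem_enum !inE !eqxx orbT.
have sQ : s =i Q.
  move=> z; rewrite !inE mem_enum !inE; case: eqVneq => [->//|_] /=.
  by case: eqVneq => [->//|].
have cs : cycle e s by apply: cyc => // z; rewrite sQ.
have [|u' c' mem'] := @skip_arc _ e s p [::] q (enum (Q :\: [set p; q])) l 0 (rot0 _) us cs pl ul.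
  by move=> z /lK /(comp_notin yQ); rewrite sQ.
eexists; split; [exact: u' | exact: c' | |].
  move=> z zY; rewrite mem'; suff -> : z = y by rewrite yl.
  exact: (card_le1_eqP Y1).
by move=> z zQ; rewrite mem' sQ zQ orbT.
Qed.

(* Kouider's lemma with at most one prescribed vertex. *)
Lemma kouider Q T Y0 k : clique Q -> 1 < #|Q| -> k <= #|Q| -> 1 < k ->
    {in T, forall t, far Q k t} -> #|Y0| <= 1 -> [disjoint Y0 & Q] ->
    {in Y0, forall y, far Q 2 y} -> (Y0 != set0 -> 2 < k) ->
  exists s, [/\ uniq s, cycle e s, {subset Y0 <= s} &
    alpha e (T :\: [set z in s]) <= alpha e T - (k - #|Y0|)].
Proof.
move=> cQ Q1 kQ k1 fT Y1 dYQ fY k2; set g := k - #|Y0|.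
have gk : g + #|Y0| = k by rewrite subnK // (leq_trans Y1) // ltnW.
(* [H] grows vertex by vertex. While the cycle covers all of [H], it is also made to contain [Q],
   since then [gates_far_sub] guarantees [k] gates. *)
suff inv n H : #|H| = n -> H \subset T -> exists s, [/\ uniq s, cycle e s, {subset Y0 <= s} &
    {subset H :|: Q <= s} \/ alpha e (H :\: [set z in s]) + g <= alpha e H].
  have [s [us cs Ys h]] := inv _ T erefl (subxx T); exists s; split => //.
  case: h => [h|h]; last by arith.
  suff -> : T :\: [set z in s] = set0 by rewrite alpha0.
  by apply/setP => z; rewrite !inE andbC; case: (boolP (z \in T)) => //= zT; rewrite h // inE zT.
elim: n H => [|n IH] H Hn HT.
  have [s [us cs Ys Qs]] := base_cycle cQ Q1 Y1 dYQ fY; exists s; split => //.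
  by left; move/eqP: Hn; rewrite cards_eq0 => /eqP->; rewrite set0U.
have /set0Pn[x xH] : H != set0 by rewrite -card_gt0 Hn.
pose H' := H :\ x; have HE : x |: H' = H by rewrite setD1K.
have [||s [us cs Ys h]] := IH H'.
- by move: Hn; rewrite (cardsD1 x) xH => -[].
- by apply: subset_trans HT; apply: subD1set.
have [xs|xs] := boolP (x \in s).
  exists s; split => //; case: h => h; [left|right].
    by move=> z; rewrite -HE -setUA in_setU1 => /predU1P[->//|/h].
  have -> : H :\: [set z in s] = H' :\: [set z in s].
    by rewrite -HE setDUl; have -> : [set x] :\: [set z in s] = set0;
       [apply/eqP; rewrite setD_eq0 sub1set inE | rewrite set0U].
  by apply: leq_trans h _; rewrite -HE alphaS // subsetUr.
pose C := [set z in s]; have xC : x \notin C by rewrite inE.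
have xT : x \in T by apply: (subsetP HT).
have H'H : alpha e H' <= alpha e H by rewrite -HE alphaS // subsetUr.
have up : alpha e (H :\: C) <= (alpha e (H' :\: C)).+1.
  apply: leq_trans (alphaU1 e x (H' :\: C)); apply: alphaS.
  by rewrite -HE setDUl setSU // subsetDl.
case: h => h.
  have QC : Q \subset C by apply/subsetP => z zQ; rewrite inE h // inE zQ orbT.
  have W_k := gates_far_sub xC (fT x xT) QC.
  have D0 (S : {set V}) : S \subset H' :|: Q -> alpha e (S :\: C) = 0.
    move=> SH; suff -> : S :\: C = set0 by rewrite alpha0.
    apply/setP => z; rewrite !inE andbC; case: (boolP (z \in S)) => //= zS.
    by rewrite h // (subsetP SH).
  have r0 := D0 _ (subsetUl H' Q).
  (* Above [g], the old cycle suffices as it misses only [x]. At exactly [g] all of [H] has to be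
     covered, but [Q] may be given up. Below [g], adding the clique [Q] to the target costs at most
     one, so both can be covered. *)
  have [big|small] := leqP g.+1 (alpha e H).
    exists s; split => //; right; rewrite -/C; arith.
  have [eqg|neg] := eqVneq (alpha e H) g.
    have [|||s' [us' cs' Ys' h']] := @cycle_step _ e e_sym s x Y0 H' g us cs xs Ys Y1.
    - by apply: leq_trans W_k.
    - by rewrite gk.
    - by rewrite HE r0 eqg.
    by exists s'; split => //; right; move: h'; rewrite HE -/C r0 eqg; arith.
  have {neg}small : alpha e H < g by rewrite ltn_neqAle neg.
  have [|||s' [us' cs' Ys' h']] := @cycle_step _ e e_sym s x Y0 (H' :|: Q) g us cs xs Ys Y1.
  - by apply: leq_trans W_k.
  - by rewrite gk.
  - rewrite setUA HE D0 //; apply: leq_trans (alphaU _ _ _) _.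
    by have := alpha_clique cQ; arith.
  exists s'; split => //; left; move: h'; rewrite setUA HE -/C D0 // leqn0 alpha_eq0 //.
  by rewrite setD_eq0 => /subsetP sub z /sub; rewrite inE.
have [ok|nok] := leqP (alpha e (H :\: C) + g) (alpha e H).
  by exists s; split => //; right.
have aH : alpha e H <= alpha e (H' :\: C) + g by arith.
have use : k <= #|gate e C x @: attach e C x| -> exists s, [/\ uniq s, cycle e s,
    {subset Y0 <= s} & {subset H :|: Q <= s} \/ alpha e (H :\: [set z in s]) + g <= alpha e H].
  move=> W_k.
  have [|||s' [us' cs' Ys' h']] := @cycle_step _ e e_sym s x Y0 H' g us cs xs Ys Y1.
  - by apply: leq_trans W_k.
  - by rewrite gk.
  - by rewrite HE.
  exists s'; split => //; right; move: h'; rewrite HE -/C; move: h; rewrite -/C; arith.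
have [/use//|TW] := gates_far cQ xC (fT x xT).
have [/use//|W_k] := leqP k #|gate e C x @: attach e C x|.
set W := gate e C x @: attach e C x in TW W_k.
have TCW : T :&: C \subset W.
  by apply/subsetP => u /setIP[uT uC]; apply: TW => //; apply: fT.
have gT : g <= #|T :&: C|.
  have : alpha e H' <= alpha e (H' :\: C) + #|T :&: C|.
    have := alphaU e (H' :&: C) (H' :\: C); rewrite setID addnC => /leq_trans; apply.
    rewrite leq_add2l.
    apply: leq_trans (alpha_card _ _) (subset_leq_card (setSI _ _)).
    by apply: subset_trans HT; apply: subD1set.
  by move: h; rewrite -/C; arith.
(* [#|W| < k <= g + 1] and [g <= #|T :&: C| <= #|W|] leave no slack. Every gate then lies on the
   cycle, so it is its own attachment, and the gaps contain no vertex of [T]. A gap free of [Y0] can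
   therefore be replaced by a detour through [x]; [2 < k] supplies the two attachments needed. *)
have WE : W = T :&: C.
  by apply/eqP; rewrite eq_sym eqEcard TCW; move: W_k; arith.
have Y_1 : #|Y0| = 1 by have := subset_leq_card TCW; arith.
have k3 : 2 < k by apply: k2; rewrite -card_gt0 Y_1.
pose P := attach e C x.
have gateE p : p \in P -> gate e C x p = p.
  move=> pP; have : gate e C x p \in W by apply: imset_f.
  case: (gateP e C x p) => // t dt _; rewrite WE inE => /andP[_ tC].
  by have [/(comp_notin xC)] := domP xC dt; rewrite tC.
have WP : W = P.
  apply/setP => z; apply/imsetP/idP => [[p pP ->]|zP]; first by rewrite gateE.
  by exists z; rewrite ?gateE.
have Ps : {subset P <= s} by move=> p /attachP[]; rewrite inE.
have [p pP [hp Yg]] : exists2 p, p \in P & has (mem P) (after s p) /\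
    {in Y0, forall y, y \notin gap s P p}.
  have /card_gt1P[p [q [pP qP pq]]] : 1 < #|P| by rewrite -WP WE; arith.
  have [yp|/hasPn np] := boolP (has (mem Y0) (gap s P p)); last first.
    exists p => //; split; first exact: has_after pq.
    by move=> y yY; apply/negP => /np; rewrite /= yY.
  case/hasP: yp => y yg /= yY; exists q => //; split.
    by apply: (has_after Ps qP pP); rewrite eq_sym.
  move=> y' y'Y; have -> : y' = y by apply: (card_le1_eqP Y1).
  exact: (gap_disjoint us Ps pP qP pq yg).
have [[J aE] nP gP] := gap_nxt hp.
have sE : rot (index p s) s = p :: gap s P p ++ nxt s P p :: J.
  by rewrite rot_after ?aE // Ps.
have pn : p != nxt s P p.
  have : uniq (p :: gap s P p ++ nxt s P p :: J) by rewrite -sE rot_uniq.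
  rewrite cons_uniq mem_cat inE => /andP[/norP[_ /norP[]]] //.
have [l [pl ul lK xl]] := link e_sym xC pP nP ltac:(by rewrite !gateE).
have [|u' c' mem'] := skip_arc sE us cs pl ul.
  by move=> z /lK /(comp_notin xC); rewrite inE.
eexists; split; [exact: u' | exact: c' | |].
  by move=> y yY; rewrite mem' Ys // Yg // orbT.
right; suff le : alpha e (H :\: [set z in p :: l ++ nxt s P p :: J]) <= alpha e (H' :\: C).
  by move: h le; rewrite -/C; arith.
apply: alphaS; apply/subsetP => z; rewrite in_setD inE mem' negb_or negb_and negbK.
move=> /andP[/andP[zl zs] zH]; have zx : z != x by apply: contraNneq zl => ->.
have -> : (z \in H' :\: C) = (z \notin s) by rewrite !inE zx zH !andbT.
case/orP: zs => // zg; apply: contra (gP z zg) => zC; rewrite -WP WE !inE zC andbT.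
exact: (subsetP HT).
Qed.

Lemma cycle_covers s : uniq s -> cycle e s -> covers e 1 [set z in s].
Proof.
move=> us cs; have [s0|s0] := eqVneq s [::].
  by rewrite s0; exists [::]; split => // z; rewrite !inE.
apply: (@covers_cyc _ _ s); last by move=> z; rewrite inE.
by rewrite /mcyc s0 us cs orbT.
Qed.

(** A cycle forced through a vertex of [F] lowers the stability number by [k - 1] and [#|F|] by at
    least one; an unforced one lowers the stability number by [k]. So the sum drops by [k], unless
    the stability number reaches 0, where [#|F| <= N] is enough. *)
Lemma kouider_covers Q k N F T : clique Q -> 1 < #|Q| -> k <= #|Q| -> 1 < k ->
    {in T, forall t, far Q k t} -> [disjoint F & Q] -> {in F, forall y, far Q 2 y} ->
    (F != set0 -> 2 < k) -> #|F| <= N -> alpha e T + #|F| <= N * k ->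
  covers e N (F :|: T).
Proof.
move=> cQ Q1 kQ k1; elim: N F T => [|N IH] F T fT dFQ fF k2 FN aT.
  have /eqP -> : F == set0 by rewrite -cards_eq0 -leqn0.
  have /eqP -> : T == set0 by rewrite -(alpha_eq0 e_irr); arith.
  by exists [::]; split => // z; rewrite !inE.
have cut (s : seq V) : covers e 1 [set z in s] ->
    covers e N (F :\: [set z in s] :|: T :\: [set z in s]) ->
    covers e N.+1 (F :|: T).
  move=> h1 h2; apply: coversS (coversU h1 h2); rewrite ?add1n //.
  rewrite -setDUl; apply/subsetP => z zS; rewrite in_setU in_setD zS andbT.
  exact: orbN.
have sub (S : {set V}) : {in T :\: S, forall t, far Q k t}.
  by move=> t /setDP[tT _]; apply: fT.
have [F0|[y yF]] := set_0Vmem F.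
  have [||||s [us cs _ h]] := @kouider Q T set0 k cQ Q1 kQ k1 fT.
  - by rewrite cards0.
  - by rewrite -setI_eq0 set0I.
  - by move=> y; rewrite inE.
  - by rewrite eqxx.
  apply: (cut s); first exact: cycle_covers.
  rewrite F0 set0D; apply: IH => //; rewrite ?F0 ?cards0 ?eqxx //.
  - by rewrite -setI_eq0 set0I.
  - by move=> y; rewrite inE.
  - by move: h aT; rewrite F0 cards0; arith.
have F1 : F != set0 by apply/set0Pn; exists y.
have k3 := k2 F1.
have [|||_|s [us cs Ys h]] := @kouider Q T [set y] k cQ Q1 kQ k1 fT.
- by rewrite cards1.
- by rewrite disjoints1 (disjointFr dFQ).
- by move=> z /set1P ->; apply: fF.
- by [].
have ys : y \in s by apply: Ys; rewrite set11.
have Fs : #|F :\: [set z in s]| < #|F|.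
  apply: proper_card; apply/properP; split; first exact: subsetDl.
  by exists y; rewrite // !inE ys.
apply: (cut s); first exact: cycle_covers.
apply: IH => //.
- by apply: disjointWl dFQ; apply: subsetDl.
- by move=> z /setDP[zF _]; apply: fF.
- arith.
- by move: h aT Fs; rewrite cards1; nia.
Qed.
End Kouider.

Section Parts.
Context (V : finType) (e : rel V).
Implicit Types (S : {set V}) (s : seq V) (ss : seq (seq V)).

Lemma mcyc_cons x s : mcyc e s -> x \notin s -> {in s, forall y, e x y && e y x} -> mcyc e (x :: s).
Proof.
case: s => // y s /and3P[_ us cs] xs h; apply/and3P; split => //.
  by rewrite cons_uniq xs.
apply/orP; right; rewrite /= rcons_path.
have [-> _] := andP (h y (mem_head y s)); have [_ ->] := andP (h _ (mem_last y s)).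
by case: s cs {us xs h} => //= z s; rewrite rcons_path => /and3P[-> ->].
Qed.

Lemma path_partition_perm S ss ss' : perm_eq ss ss' ->
  path_partition e S ss -> path_partition e S ss'.
Proof.
move=> p [a u f]; split; first by rewrite -(perm_all _ p).
  by rewrite -(perm_uniq (perm_flatten p)).
by move=> z; rewrite -(perm_mem (perm_flatten p)) f.
Qed.

Lemma path_partition_cat S ss ss' : path_partition e S (ss ++ ss') ->
  path_partition e (S :\: [set z in flatten ss]) ss'.
Proof.
case; rewrite all_cat flatten_cat cat_uniq => /andP[_ a] /and3P[_ /hasPn d u] f.
split=> // z; rewrite in_setD inE -f mem_cat.
by case: (boolP (z \in flatten ss')) => [/d/= /negbTE->//|_]; rewrite orbF andNb.
Qed.
End Parts.

(** * The small cuts of one colour *)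

Section Colour.
Context (V : finType) (e e' : rel V).
Hypotheses (e_sym : symmetric e) (e_irr : irreflexive e).
Hypotheses (e'_sym : symmetric e') (e'_irr : irreflexive e').
Hypothesis co : forall x y, x != y -> e' x y = ~~ e x y.
Context (k : nat).
Hypotheses (Vk : #|V| <= k * k).
Hypotheses (nc' : ~ covers e' k setT).
Context (Q : {set V}).
Hypotheses (cQ : clique e Q) (Qa : #|Q| = alpha e' setT).
Implicit Types (S X Y Z I T : {set V}).

Lemma stable_clique I : stable e' I -> clique e I.
Proof.
move=> /stableP sI a b aI bI ab; have := sI a b aI bI.
by rewrite co // negbK.
Qed.

Lemma bd_co Y : {in ~: (Y :|: bd e Y) & Y, forall x y, e' x y}.
Proof.
move=> x y; rewrite in_setC in_setU negb_or => /andP[xY xb] yY.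
have xy : x != y by apply: contraNneq xY => ->.
rewrite co // e_sym; apply: contra xb => yx; rewrite inE xY.
by apply/exists_inP; exists y.
Qed.

Lemma k_lt_hub : k < #|Q|.
Proof.
by rewrite ltnNge; apply/negP; rewrite Qa => /(covers_posa e'_sym e'_irr).
Qed.

Lemma hub_le : #|Q| <= k * k.
Proof. exact: leq_trans (max_card _) Vk. Qed.

Lemma k_gt1 : 1 < k.
Proof. by move: k_lt_hub hub_le; case: (k) => [|[|]]; arith. Qed.

(** Otherwise [Y] and the far side [X] both have at least [k] vertices and at most [k * k] together.
    As [e'] is complete between them, [k - 1] cycles cover both, and one more takes the boundary
    vertex. *)
Lemma small_side Y : [disjoint Y & Q] -> #|bd e Y| <= 1 -> #|Y| < k.
Proof.
move=> dYQ b1; rewrite ltnNge; apply/negP => kY; apply: nc'.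
set X := ~: (Y :|: bd e Y); have k1 := k_gt1.
have dXY : [disjoint X & Y].
  by rewrite disjoint_sym disjoints_subset setCK subsetUl.
have dYb : [disjoint Y & bd e Y].
  by apply/pred0P => v /=; rewrite inE; case: (v \in Y).
have nXY : #|X| + #|Y| <= k * k.
  apply: leq_trans Vk; apply: leq_trans (max_card (X :|: Y)).
  by rewrite cardsU disjoint_setI0 // cards0 subn0.
have QX : #|Q| <= #|X| + #|bd e Y|.
  apply: leq_trans (leq_card_setU _ _); apply: subset_leq_card.
  apply/subsetP => v vQ; rewrite in_setU /X in_setC in_setU (disjointFl dYQ) //=.
  exact: orNb.
have kQ := k_lt_hub.
have kX : k <= #|X| by arith.
have cXY : covers e' k.-1 (X :|: Y).
  apply: covers_bipartite_alpha => //; try (by rewrite -card_gt0; arith).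
  - exact: bd_co.
  - apply: leq_trans (alpha_card _ _) _; move: k1 kY nXY.
    by move: #|X| #|Y|; clear; move=> x y; nia.
  - apply: leq_trans (alpha_card _ _) _; move: k1 kX nXY.
    by move: #|X| #|Y|; clear; move=> x y; nia.
apply: coversS (coversU cXY (covers_card e' (bd e Y))); first by arith.
by apply/subsetP => v _; rewrite !in_setU /X in_setC in_setU; case: (v \in Y); case: (v \in bd e Y).
Qed.

Definition cut_off s :=
  [set v | [exists Y : {set V}, [&& v \in Y, [disjoint Y & Q] & #|bd e Y| <= s]]].

Lemma cut_offP s v :
  reflect (exists Y, [/\ v \in Y, [disjoint Y & Q] & #|bd e Y| <= s]) (v \in cut_off s).
Proof.
by rewrite inE; apply: (iffP existsP) => -[Y] => [/and3P|] h; exists Y => //; apply/and3P.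
Qed.

Lemma cut_off_far s v : v \notin cut_off s -> far e Q s.+1 v.
Proof.
move=> /cut_offP nL Y vY dY; rewrite ltnNge; apply/negP => b; apply: nL.
by exists Y.
Qed.

Lemma cut_off_mono s t : s <= t -> cut_off s \subset cut_off t.
Proof.
move=> st; apply/subsetP => v /cut_offP[Y [vY dY b]]; apply/cut_offP; exists Y; split => //.
exact: leq_trans st.
Qed.

Lemma cut_off_disjoint s : [disjoint cut_off s & Q].
Proof. by apply/pred0P => v /=; apply/negP => /andP[/cut_offP[Y [vY /disjointFr->]]]. Qed.

Lemma cut_off_sub Y s : [disjoint Y & Q] -> #|bd e Y| <= s -> Y \subset cut_off s.
Proof. by move=> dY b; apply/subsetP => v vY; apply/cut_offP; exists Y. Qed.

Lemma disjointU Y Z : [disjoint Y & Q] -> [disjoint Z & Q] -> [disjoint Y :|: Z & Q].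
Proof. by rewrite -!setI_eq0 setIUl => /eqP-> /eqP->; rewrite setU0. Qed.

(** The vertex [u] is swallowed by [Z] and disappears from the joint boundary. *)
Lemma bdU Y Z u : u \in bd e Y -> u \in Z -> #|bd e (Y :|: Z)| < #|bd e Y| + #|bd e Z|.
Proof.
move=> uY uZ; apply: leq_ltn_trans (_ : #|bd e Y :\ u :|: bd e Z| < _).
  apply/subset_leq_card/subsetP => v; rewrite inE in_setU negb_or in_setU in_setD1.
  move=> /andP[/andP[vY vZ] /exists_inP[w]].
  have vu : v != u by apply: contraNneq vZ => ->.
  rewrite vu in_setU /= => /orP[wY|wZ] wv; apply/orP; [left|right].
    by rewrite inE vY; apply/exists_inP; exists w.
  by rewrite inE vZ; apply/exists_inP; exists w.
apply: leq_ltn_trans (leq_card_setU _ _) _.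
by rewrite [#|bd e Y|](cardsD1 u) uY -addnA add1n.
Qed.

(** * The vertices cut off by a single vertex *)

Let M := cut_off 1.
Let m := #|M|.

(** Within one side [Y] this is [small_side]. If the clique contains the boundary vertex [u] of [Y],
    then [Y] is merged with a side of [u]; by [bdU] the union again has at most one boundary
    vertex. *)
Lemma clique_M R : clique e R -> R \subset M -> #|R| < k.
Proof.
move=> cR RM; have [->|[r rR]] := set_0Vmem R.
  by rewrite cards0 (ltn_trans _ k_gt1).
have /cut_offP[Y [rY dY bY]] := subsetP RM r rR.
have RY := bd_clique cR rR rY.
have [RY0|] := boolP (R \subset Y).
  by apply: leq_ltn_trans (subset_leq_card RY0) (small_side dY bY).
case/subsetPn => u uR uY.
have ub : u \in bd e Y by have := subsetP RY u uR; rewrite in_setU (negbTE uY).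
have /cut_offP[Z [uZ dZ bZ]] := subsetP RM u uR.
apply: leq_ltn_trans (_ : #|Y :|: Z| < k).
  apply/subset_leq_card/subsetP => w wR; rewrite in_setU.
  have := subsetP RY w wR; rewrite in_setU => /orP[-> //|wb].
  by have -> : w = u by [apply: (card_le1_eqP bY)]; rewrite uZ orbT.
apply: small_side; first exact: disjointU.
have := bdU ub uZ; arith.
Qed.

Lemma alpha_M : alpha e' M < k.
Proof. by have [I /stable_clique cI [IM <-]] := alpha_ex e' M; apply: clique_M. Qed.

(** A side witnessing [y \in M] lies entirely in [M], so neighbours outside [M] are in its
    boundary. *)
Lemma outer_uniq y u v : y \in M -> u \notin M -> v \notin M -> e y u -> e y v -> u = v.
Proof.
move=> /cut_offP[Y [yY dY bY]] uM vM yu yv; have YM := cut_off_sub dY bY.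
apply: (card_le1_eqP bY); rewrite inE.
  by rewrite (contra (subsetP YM v)) //; apply/exists_inP; exists y.
by rewrite (contra (subsetP YM u)) //; apply/exists_inP; exists y.
Qed.

Definition outer := [set c in ~: M | [exists y in M, e y c]].

Lemma outerP c : reflect (c \notin M /\ exists2 y, y \in M & e y c) (c \in outer).
Proof.
by rewrite [c \in outer]in_set in_setC; apply: (iffP andP) => -[cM] => /exists_inP.
Qed.

Lemma outer_inv : exists g : V -> V, {in outer, forall c, g c \in M /\ e (g c) c}.
Proof.
have h c : exists y, c \in outer -> y \in M /\ e y c.
  have [/outerP[_ [y yM yc]]|ncO] := boolP (c \in outer); first by exists y.
  by exists c.
by have [g gP] := fin_all_exists h; exists g.
Qed.

Lemma outer_inj g : {in outer, forall c, g c \in M /\ e (g c) c} -> {in outer &, injective g}.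
Proof.
move=> gP c d cO dO E; have [gM gc] := gP c cO; have [gM' gd] := gP d dO.
have [cM _] := outerP _ cO; have [dM _] := outerP _ dO.
by apply: outer_uniq gM cM dM gc _; rewrite E.
Qed.

Lemma outer_card : #|outer| <= m.
Proof.
have [g gP] := outer_inv; rewrite -(card_in_imset (outer_inj gP)).
by apply/subset_leq_card/subsetP => _ /imsetP[c /gP[gM _] ->].
Qed.

Lemma inner_co : {in M & ~: M :\: outer, forall y w, e' y w}.
Proof.
move=> y w yM; rewrite in_setD in_setC => /andP[wo wM].
have yw : y != w by apply: contraNneq wM => <-.
rewrite co //; apply: contra wo => yw'; apply/outerP; split => //; by exists y.
Qed.

Lemma covers_outer : covers e m (M :|: outer).
Proof.
pose f y := if [pick c in outer | e y c] is Some c then [:: y; c] else [:: y].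
exists [seq f y | y <- enum M]; split.
- apply/allP => s /mapP[y]; rewrite mem_enum => yM ->; rewrite /f.
  case: pickP => [c /andP[cO yc]|_]; last by rewrite /mcyc.
  have yc' : y != c by apply: contraTneq yM => ->; have [] := outerP _ cO.
  by rewrite /mcyc /= inE yc' yc e_sym yc.
- by rewrite size_map -cardE.
- move=> v; rewrite in_setU => /orP[vM|vO].
    apply/flattenP; exists (f v); first by apply: map_f; rewrite mem_enum.
    by rewrite /f; case: pickP => [c _|_]; rewrite mem_head.
  have [vM [y yM yv]] := outerP _ vO.
  apply/flattenP; exists (f y); first by apply: map_f; rewrite mem_enum.
  rewrite /f; case: pickP => [c /andP[cO yc]|/(_ v)]; last by rewrite vO yv.
  have [cM _] := outerP _ cO.
  by rewrite (outer_uniq yM vM cM yv yc) !inE eqxx orbT.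
Qed.


Lemma inner_compl : setT = M :|: (~: M :\: outer) :|: outer.
Proof.
apply/setP => v; rewrite !in_setU in_setD in_setC in_setT.
by case: (v \in M); case: (v \in outer).
Qed.

Lemma disjoint_M S : S \subset ~: M -> [disjoint M & S].
Proof. by move=> SW; rewrite disjoint_sym disjoints_subset. Qed.

(* Each cycle can alternate between the [m] vertices of [M] and [m] parts. *)
Lemma covers_parts S ss N : M != set0 -> S \subset ~: M :\: outer -> path_partition e' S ss ->
    all (mcyc e') ss -> size ss <= N * m -> k <= N.+2 -> 0 < N ->
  covers e' N S.
Proof.
move=> M0 SW pS ms sz kN N0; have [small|big] := leqP (size ss) N.
  exists ss; split => //; by case: pS => _ _ f v vS; rewrite f.
have S_N : N < #|S|.
  apply: leq_trans big _; rewrite (card_path_partition pS).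
  case: pS => a _ _; elim: (ss) a => //= -[|x s] ts IH //= /andP[_ /IH].
  by rewrite size_cat ltnS => /leq_trans; apply; apply: leq_addl.
have S0 : S != set0 by rewrite -card_gt0; arith.
have [Px [pX _ sX]] := posa_partition e'_sym e'_irr M; have aM := alpha_M.
apply: (@coversS _ _ N N (M :|: S)) => //; first exact: subsetUr.
apply: (covers_bipartite e'_sym M0 S0 _ _ pX _ pS sz).
- by apply: disjoint_M; apply: subset_trans SW (subsetDl _ _).
- by move=> y w yM /(subsetP SW); apply: inner_co.
- apply: leq_trans sX _; apply: leq_trans (leq_pmull _ N0).
  by move: aM S_N kN; rewrite /M; arith.
Qed.

Lemma covers_inner S : M != set0 -> S \subset ~: M :\: outer -> #|Q| <= k.-1 * m ->
  covers e' k.-1 (M :|: S).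
Proof.
move=> M0 SW Qm; have aM := alpha_M; have k1 := k_gt1.
have [S0|S0] := eqVneq S set0.
  by rewrite S0 setU0; apply: covers_posa => //; arith.
apply: covers_bipartite_alpha => //.
- by apply: disjoint_M; apply: subset_trans SW (subsetDl _ _).
- by move=> y w yM /(subsetP SW); apply: inner_co.
- apply: leq_trans (_ : k.-1 <= _); first by arith.
  by rewrite -{1}[k.-1]muln1 leq_mul2l card_gt0 S0 orbT.
- by apply: leq_trans Qm; rewrite Qa alphaS ?subsetT.
Qed.

Lemma covers_spare S : M != set0 -> #|Q| <= k.-1 * m -> covers e' 1 S -> outer \subset S ->
  covers e' k setT.
Proof.
move=> M0 Qm cS oS; have k1 := k_gt1.
apply: coversS (coversU (covers_inner M0 (subxx _) Qm) cS); first by clear - k1; lia.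
by rewrite {1}inner_compl setUS.
Qed.

Lemma next_neq (T : eqType) (s : seq T) c : uniq s -> 2 < size s -> c \in s ->
  (next s c != c) && (next s (next s c) != c).
Proof.
move=> us sz cs; have [i s' E] := rot_to cs.
rewrite -!(next_rot i us) E; move: us sz; rewrite -(rot_uniq i) -(size_rot i) E.
case: s' {E} => [|d [|f s']] //= /and3P[]; rewrite !inE !negb_or => /and3P[cd cf _] _ _ _.
by rewrite !eqxx eq_sym (negbTE cd) eq_sym cf.
Qed.

Lemma matched_edge y c w : y \in M -> c \notin M -> e y c -> w \notin M -> w != c -> e' y w.
Proof.
move=> yM cM yc wM wc; have yw : y != w by apply: contraNneq wM => <-.
rewrite co //; apply: contra wc => yw'; apply/eqP.
exact: outer_uniq yM wM cM yw' yc.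
Qed.

Lemma outer_cycle : 2 < #|outer| -> covers e' 1 outer.
Proof.
move=> o3; have [g gP] := outer_inv; pose s := enum outer.
have us : uniq s by apply: enum_uniq.
have s3 : 2 < size s by rewrite -cardE.
have sO c : (c \in s) = (c \in outer) by rewrite mem_enum.
have gM c : c \in outer -> g c \in M by case/gP.
have ge c w : c \in outer -> w \notin M -> w != c -> e' (g c) w.
  by move=> cO; have [cM _] := outerP _ cO; have [gcM gc] := gP c cO; apply: matched_edge gc.
(* Between [c] and its successor goes the chosen partner in [M] of the vertex after them. The only
   [e]-neighbour of that partner outside [M] is this third vertex, which differs from both because
   there are at least three. *)
pose nn c := next s (next s c); pose h c := [:: g (nn c)].
have nO c : c \in outer -> nn c \in outer by rewrite -!sO !mem_next.
have sz : size s = size (map h s) by rewrite size_map.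
have fl : flatten (map h s) = [seq g (nn c) | c <- s] by elim: (s) => //= a t ->.
have zE : zip s (map h s) = [seq (c, h c) | c <- s] by elim: (s) => //= a t ->.
have x0 : V by case: (s) s3.
have mc : mcyc e' (interleave s (map h s)).
  apply: (mcyc_interleave (x0 := x0)) => //.
  - by case: (s) s3.
  - rewrite fl cat_uniq us map_inj_in_uniq ?us ?andbT.
      apply/hasPn => z /mapP[c]; rewrite sO => /nO/gM gcM ->; rewrite /= sO.
      by apply/negP => /outerP[]; rewrite gcM.
    move=> c d; rewrite !sO => cO dO /(outer_inj gP (nO _ cO) (nO _ dO)).
    by move/(can_inj (prev_next us)) /(can_inj (prev_next us)).
  - by apply/allP => _ /mapP[c _ ->].
  - rewrite zE -map_comp cycle_map.
    apply: (@sub_in_cycle _ (mem s) (frel (next s)) _ _ s _ (cycle_next us)).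
      move=> c d cs _ /= /eqP<-; rewrite /blink /=; apply: ge.
      - by apply: nO; rewrite -sO.
      - by have := mem_next s c; rewrite cs sO => /outerP[].
      - by have /andP[nd _] := next_neq us s3 (etrans (mem_next s c) cs); rewrite eq_sym.
    by apply/allP.
  - move=> yP; rewrite zE => /mapP[c cs ->] /=; rewrite e'_sym; apply: ge.
    + by apply: nO; rewrite -sO.
    + by move: cs; rewrite sO => /outerP[].
    + by have /andP[_ nd] := next_neq us s3 cs; rewrite eq_sym.
apply: covers_cyc mc _ => c cO.
by rewrite (perm_mem (perm_interleave sz)) mem_cat sO cO.
Qed.

Lemma octagon c1 c2 : outer = [set c1; c2] -> c1 != c2 -> 2 < k ->
    1 < #|[set y in M | e y c1]| -> 1 < #|[set y in M | e y c2]| ->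
  covers e' 1 outer.
Proof.
move=> oE cc k2 /card_gt1P[a1 [b1 [a1P b1P ab1]]] /card_gt1P[a2 [b2 [a2P b2P ab2]]].
have [[a1M a1c] [b1M b1c]] := (setIdP a1P, setIdP b1P).
have [[a2M a2c] [b2M b2c]] := (setIdP a2P, setIdP b2P).
have /card_gt1P[w [w' [wI wI' ww]]] : 1 < #|~: M :\: outer|.
  apply: leq_trans (_ : #|Q :\: outer| <= _).
    by have := cardsID outer Q; have := subset_leq_card (subsetIr Q outer);
       rewrite oE cards2 cc; have := k_lt_hub; move: k2; clear; lia.
  by apply/subset_leq_card/setSD; rewrite -disjoints_subset disjoint_sym cut_off_disjoint.
have [c1M c2M] : c1 \notin M /\ c2 \notin M.
  by split; [have /outerP[] : c1 \in outer by rewrite oE set21 |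
             have /outerP[] : c2 \in outer by rewrite oE set22].
have [[wM wo] [wM' wo']] : (w \notin M /\ w \notin outer) /\ (w' \notin M /\ w' \notin outer).
  by move: wI wI'; rewrite !in_setD !in_setC => /andP[-> ->] /andP[-> ->].
have [[wc1 wc2] [wc1' wc2']] : (w != c1 /\ w != c2) /\ (w' != c1 /\ w' != c2).
  by move: wo wo'; rewrite oE !in_set2 !negb_or => /andP[-> ->] /andP[-> ->].
have other z : z \in M -> e z c1 -> e z c2 = false.
  move=> zM h; apply: contraNF cc => h'; apply/eqP; exact: outer_uniq zM c1M c2M h h'.
pose s := [:: c1; a2; w; a1; c2; b1; w'; b2].
apply: (@covers_cyc _ _ s); last first.
  by move=> z; rewrite oE !inE => /orP[]/eqP->; rewrite eqxx ?orbT.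
have out z c : z \in M -> c \notin M -> z != c by move=> zM; apply: contraNneq => <-.
have tw z z' : z \in M -> e z c1 -> e z' c2 -> z != z'.
  by move=> zM h; apply: contraTneq => <-; rewrite other.
apply/and3P; split=> //.
  rewrite /= !inE !negb_or -!andbA.
  by repeat (apply/andP; split); rewrite //; solve [by apply: out | by rewrite eq_sym out
    | by apply: tw | by rewrite eq_sym tw | by rewrite eq_sym].
rewrite orbC /= !(e'_sym _ a2) !(e'_sym _ a1) !(e'_sym _ b1) !(e'_sym _ b2).
by rewrite !(@matched_edge _ c1 _ a1M, @matched_edge _ c1 _ b1M,
             @matched_edge _ c2 _ a2M, @matched_edge _ c2 _ b2M) // eq_sym.
Qed.


(* [c1] has a single neighbour [a1] in [M].  The part containing [c2] is closed up
   through [a1], the one containing [c1] through [M :\ a1], and all other parts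
   are free of conflicts. *)
Lemma star_case c1 c2 : outer = [set c1; c2] -> c1 != c2 -> 2 < k -> 1 < m ->
    #|[set y in M | e y c1]| <= 1 -> #|Q| <= k.-1 * m ->
  covers e' k setT.
Proof.
move=> oE cc k2 m1 A1 Qm.
have [c1M [a1 a1M a1c]] : c1 \notin M /\ exists2 y, y \in M & e y c1.
  by apply/outerP; rewrite oE set21.
have [c2M _] : c2 \notin M /\ exists2 y, y \in M & e y c2.
  by apply/outerP; rewrite oE set22.
have M0 : M != set0 by apply/set0Pn; exists a1.
have aM := alpha_M.
have a1_co w : w \notin M -> w != c1 -> e' a1 w.
  by move=> wM wc; apply: matched_edge a1M c1M a1c wM wc.
pose M2 := M :\ a1.
have mM2 : m = #|M2|.+1 by rewrite /m (cardsD1 a1) a1M.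
have M2_co y w : y \in M2 -> w \notin M -> w != c2 -> e' y w.
  rewrite in_setD1 => /andP[ya yM] wM wc.
  have [wo|wo] := boolP (w \in outer); last by apply: inner_co; rewrite // in_setD wo in_setC.
  have {wo} -> : w = c1 by move: wo; rewrite oE in_set2 (negbTE wc) orbF => /eqP.
  have yc : y != c1 by apply: contraNneq c1M => <-.
  rewrite co //; apply: contra ya => yc1; apply/eqP/(card_le1_eqP A1); rewrite inE.
    by rewrite a1M.
  by rewrite yM.
have [ss [pS ms szS]] := posa_partition e'_sym e'_irr (~: M).
have {szS} szS : size ss <= k.-1 * m.
  by apply: leq_trans szS (leq_trans _ Qm); rewrite Qa alphaS ?subsetT.
have /flattenP[I Iss c2I] : c2 \in flatten ss by case: pS => _ _ ->; rewrite in_setC.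
have pI := perm_to_rem Iss; move: (rem I ss) pI => ts pI.
move/(path_partition_perm pI): pS => pS; move: ms szS; rewrite (perm_all _ pI) (perm_size pI).
move=> /= /andP[mI mts] szS.
have pT : path_partition e' (~: M :\: [set z in I]) ts.
  by have := @path_partition_cat _ _ _ [:: I] ts pS; rewrite /= cats0.
have I_M z : z \in I -> z \notin M.
  by case: pS => _ _ f zI; rewrite -in_setC -f /= mem_cat zI.
have cI : covers e' 1 [set z in I] by apply: covers_cyc mI _ => z; rewrite inE.
set W1 := ~: M :\: [set z in I] in pT.
have W1P w : (w \in W1) = (w \notin I) && (w \notin M) by rewrite in_setD in_setC inE.
have W1c2 w : w \in W1 -> w != c2 by rewrite W1P => /andP[wI _]; apply: contraNneq wI => ->.
have T v : [|| v \in M, v \in I | v \in W1].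
  by rewrite W1P; case: (v \in M) (v \in I) => [] [].
have [c1I|c1I] := boolP (c1 \in I).
  apply: coversS (coversU (covers_inner (S := W1) M0 _ Qm) cI).
  - by move: k2; clear; lia.
  - apply/subsetP => v _; rewrite !in_setU [v \in [set _ in _]]inE.
    by have := T v; case: (v \in M); case: (v \in I); case: (v \in W1).
  apply/subsetP => v vW; rewrite in_setD oE in_set2 negb_or (W1c2 v vW) in_setC.
  move: vW; rewrite W1P => /andP[vI ->]; rewrite !andbT.
  by apply: contraNneq vI => ->.
have {cI} cI : covers e' 1 (a1 |: [set z in I]).
  apply: (@covers_cyc _ _ (a1 :: I)); last by move=> z; rewrite !inE.
  apply: mcyc_cons => //; first by apply/negP => /I_M; rewrite a1M.
  move=> z zI; rewrite (e'_sym z) andbb; apply: a1_co; first exact: I_M.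
  by apply: contraNneq c1I => <-.
have c1W : c1 \in W1 by rewrite W1P c1I.
have cover_all N N' S S' : covers e' N (M2 :|: S) -> covers e' N' S' -> W1 \subset S :|: S' ->
    N + N' < k -> covers e' k setT.
  move=> h1 h2 /subsetP SS NN; apply: coversS (coversU (coversU h1 h2) cI).
    by rewrite addn1.
  apply/subsetP => v _; rewrite in_setU in_setU in_setU in_setU1 [v \in [set _ in _]]inE.
  case/or3P: (T v) => [vM|->|/SS].
  - by rewrite in_setD1 vM andbT; case: eqVneq; rewrite ?orbT.
  - by rewrite !orbT.
  - by rewrite in_setU => /orP[]->; rewrite ?orbT.
have M2_M y : y \in M2 -> y \in M by case/setD1P.
have M20 : 0 < #|M2| by move: m1; rewrite mM2.
(* With few parts, [M2] alone serves all of them in [k - 1] cycles. Otherwise one cycle through [M2]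
   takes [J] with [n] further parts, and all of [M] is available for the rest. *)
have [few|many] := leqP (size ts) (k.-1 * #|M2|).
  have [Px [pX _ sX]] := posa_partition e'_sym e'_irr M2.
  have W10 : 0 < #|W1| by rewrite card_gt0; apply/set0Pn; exists c1.
  have {}sX : size Px <= k.-1 * #|W1|.
    apply: leq_trans sX (leq_trans (alphaS e' (subD1set M a1)) _).
    by rewrite -ltnS; apply: leq_trans aM _; move: k2 W10; clear; move: #|W1| => w; nia.
  apply: (cover_all k.-1 0 W1 set0); rewrite ?setU0 //; last by move: k2; clear; lia.
    apply: (covers_bipartite e'_sym _ _ _ _ pX sX pT few); rewrite -?card_gt0 //.
      by apply/pred0P => v /=; rewrite W1P; apply/negP => /and3P[/M2_M->].
    move=> y w yM wW; apply: M2_co => //; last exact: W1c2.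
    by move: wW; rewrite W1P => /andP[].
  by exists [::]; split => // z; rewrite !inE.
have /flattenP[J Jts c1J] : c1 \in flatten ts by case: pT => _ _ ->.
have pJ := perm_to_rem Jts; move: (rem J ts) pJ => us pJ.
move/(path_partition_perm pJ): pT => pT; move: mts szS many. rewrite (perm_all _ pJ) (perm_size pJ).
move=> /= mts szS many; pose n := #|M2|.-1.
pose Ps := J :: take n us; pose rest := drop n us.
have E : J :: us = Ps ++ rest by rewrite /= cat_take_drop.
have nM : #|M2| = n.+1 by rewrite prednK.
have nus : n <= size us.
  rewrite -ltnS -nM -ltnS ltnS; apply: leq_trans (ltnW many).
  by apply: leq_pmull; move: k2; clear; lia.
rewrite E in pT; case: (pT); rewrite all_cat flatten_cat cat_uniq.
move=> /andP[aP _] /and3P[uP _ _] fP.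
have mR : all (mcyc e') rest.
  by case/andP: mts => _; rewrite -{1}(cat_take_drop n us) all_cat => /andP[].
have PW z : z \in flatten Ps -> z \in W1 by move=> zP; rewrite -fP mem_cat zP.
have adj y P z : y \in enum M2 -> P \in Ps -> z \in P -> e' y z.
  rewrite mem_enum => yM PP zP; have zW : z \in W1 by apply: PW; apply/flattenP; exists P.
  by apply: M2_co (W1c2 _ zW) => //; move: zW; rewrite W1P => /andP[].
have [|||||cs [mc sc fc]] := @cycles_through_blocks _ e' c1 (enum M2) Ps 1.
- by rewrite -size_eq0 -cardE -lt0n.
- rewrite cat_uniq enum_uniq uP andbT /=; apply/hasPn => z /PW; rewrite W1P => /andP[_ zM].
  by rewrite /= mem_enum; apply: contra zM; apply: M2_M.
- exact: aP.
- move=> y P yM PP; have /andP[P0 _] := allP aP P PP.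
  case: P P0 PP => // h t _ PP; rewrite (e'_sym (last _ _)).
  by rewrite !(adj y _ _ yM PP) /= ?mem_head ?mem_last.
- by rewrite -cardE nM /= size_takel // mul1n leqnn.
(* The bound [k.-1 * m] counts [I], [J] and [us], and [n] is [m - 2]; so at most [(k - 2) * m] parts
   remain. *)
have cR : covers e' k.-2 (W1 :\: [set z in flatten Ps]).
  apply: (covers_parts (ss := rest) M0) => //; last by move: k2; clear; lia.
  - apply/subsetP => v; rewrite in_setD inE => /andP[vP vW].
    rewrite in_setD oE in_set2 negb_or (W1c2 v vW) in_setC.
    move: vW; rewrite W1P => /andP[_ ->]; rewrite !andbT.
    by apply: contraNneq vP => ->; rewrite /= mem_cat c1J.
  - exact: path_partition_cat.
  - rewrite size_drop; move: szS nus mM2 nM k2; rewrite -/m; move: (size us) #|M2| m.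
    by clear; move=> u a b; nia.
  - by move: k2; clear; lia.
apply: (cover_all 1 k.-2 [set z in flatten Ps] _ _ cR).
- exists cs; split => // z; rewrite in_setU inE => z_; apply: fc.
  by rewrite mem_cat mem_enum.
- by apply/subsetP => z zW; rewrite in_setU in_setD zW andbT orbN.
- by move: k2; clear; lia.
Qed.

(** With a smaller hub, [k - 1] cycles of colour [e'] alternating between [M] and the other vertices
    would cover all but [outer], and one more cycle usually covers [outer]. With exactly two outer
    vertices this takes the octagon, or [star_case] if one of them has a single neighbour in [M]. *)
Theorem hub_large : 1 < m -> k.-1 * m < #|Q|.
Proof.
move=> m1; rewrite ltnNge; apply/negP => Qm; apply: nc'.
have M0 : M != set0 by rewrite -card_gt0 ltnW.
have k1 := k_gt1.
have k2 : 2 < k.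
  have : m + #|Q| <= k * k.
    apply: leq_trans Vk; apply: leq_trans (max_card (M :|: Q)).
    by rewrite cardsU disjoint_setI0 ?cut_off_disjoint // cards0 subn0.
  by move: m1 k1 k_lt_hub; clear; case: k => [|[|[|]]] //; lia.
have [o3|o2] := ltnP 2 #|outer|; first exact: covers_spare M0 Qm (outer_cycle o3) (subxx _).
move: o2; rewrite leq_eqVlt => /orP[o2|o1]; last first.
  apply: (covers_spare (S := outer)) => //.
  by apply: coversS (covers_card e' outer).
have /cards2P[c1 [c2 [cc oE]]] := o2.
have [A1|A1] := leqP #|[set y in M | e y c1]| 1; first exact: star_case oE cc k2 m1 A1 Qm.
have [A2|A2] := leqP #|[set y in M | e y c2]| 1.
  by apply: (@star_case c2 c1); rewrite // 1?setUC // eq_sym.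
exact: covers_spare M0 Qm (octagon oE cc k2 A1 A2) (subxx _).
Qed.

Lemma card_M_hub : m + #|Q| <= k * k.
Proof.
apply: leq_trans Vk; apply: leq_trans (max_card (M :|: Q)).
by rewrite cardsU disjoint_setI0 ?cut_off_disjoint // cards0 subn0.
Qed.

Lemma card_M : m < k.
Proof.
have k1 := k_gt1; have [m1|m1] := leqP m 1; first exact: leq_ltn_trans k1.
have := hub_large m1; have := card_M_hub; move: k1; move: m #|Q|; clear.
by move=> a q; nia.
Qed.

Lemma M_sub_cut_off s : 0 < s -> M \subset cut_off s.
Proof. exact: cut_off_mono. Qed.

(** A stable subset of [T], the set [S] and the hub overlap in at most one vertex, since a stable
    set meets a clique at most once. *)
Lemma alpha_card_hub S T : [disjoint T & S] -> [disjoint S & Q] ->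
  alpha e T + #|S| + #|Q| <= #|V|.+1.
Proof.
move=> dTS dSQ; have [I sI [IT <-]] := alpha_ex e T.
have IQ : #|I :&: Q| <= 1.
  apply: leq_trans (alpha_clique e_sym cQ); apply: alpha_ge (subsetIr _ _).
  by apply: stableS sI; apply: subsetIl.
have := cardsUI I Q; have : #|S :|: (I :|: Q)| <= #|V| by apply: max_card.
rewrite cardsU disjoint_setI0 ?cards0.
  by move: IQ; arith.
rewrite -setI_eq0 setIUr setU_eq0 !setI_eq0 dSQ andbT disjoint_sym.
exact: disjointWl dTS.
Qed.

(** * The level of the cuts when neither colour has a cover *)

Hypothesis nc : ~ covers e k setT.

(** Otherwise colour [e] has a cover: [covers_outer] spends [m] cycles on [M] and [outer], and
    [kouider_covers] covers the rest with [k - m] cycles, forced through the vertices of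
    [cut_off kap.-1] still missing. *)
Lemma gap_bound kap : 1 < kap <= k -> #|cut_off kap.-1| <= k ->
  (k - m) * kap + m < alpha e (~: cut_off kap.-1 :\: outer) + #|cut_off kap.-1|.
Proof.
case/andP=> kap1 kapk Lk; rewrite ltnNge; apply/negP => le; apply: nc.
have kap0 : 0 < kap.-1 by rewrite -ltnS prednK // ltnW.
have ML := M_sub_cut_off kap0; have mk := card_M; have kQ := k_lt_hub.
have kapE : kap.-1.+1 = kap by rewrite prednK // ltnW.
set l := cut_off kap.-1 in le Lk ML *; set T := ~: l :\: outer in le.
pose F := (l :\: M) :\: outer.
have Fl : #|F| + m <= #|l|.
  rewrite /m -(cardsID M l) (setIidPr ML) addnC leq_add2l.
  exact/subset_leq_card/subsetDl.
have cF : covers e (k - m) (F :|: T).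
  apply: (kouider_covers e_sym e_irr cQ (k := kap)) => //.
  - by move: kQ kap1 kapk; arith.
  - by move: kQ kap1 kapk; arith.
  - by move=> t /setDP[]; rewrite in_setC => /cut_off_far; rewrite kapE.
  - by apply: disjointWl (cut_off_disjoint kap.-1);
       apply: subset_trans (subsetDl _ _) (subsetDl _ _).
  - by move=> y /setDP[/setDP[_ /cut_off_far]].
  - apply: contraNT; rewrite -leqNgt => kap2.
    have kap_2 : kap = 2 by apply/eqP; rewrite eqn_leq kap2.
    by rewrite /F /l kap_2 setDv set0D.
  - by move: Fl Lk; arith.
  - by move: Fl le; arith.
apply: coversS (coversU covers_outer cF); first by rewrite subnKC // ltnW.
apply/subsetP => v _; rewrite /F /T !in_setU !in_setD in_setC.
by case: (v \in M); case: (v \in outer); case: (v \in l).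
Qed.

(** If not, [gap_bound] for [kap = k] and [alpha_card_hub] give [#|Q| <= k.-1 * m], against
    [hub_large], or against [k < #|Q|] when [m <= 1]. *)
Lemma card_top : k < #|cut_off k.-1|.
Proof.
rewrite ltnNge; apply/negP => Lk; have k1 := k_gt1; have mk := card_M; have kQ := k_lt_hub.
have := gap_bound _ Lk; rewrite k1 leqnn => /(_ isT).
have : alpha e (~: cut_off k.-1 :\: outer) + #|cut_off k.-1| + #|Q| <= #|V|.+1.
  apply: alpha_card_hub; last exact: cut_off_disjoint.
  by rewrite disjoints_subset subsetDl.
move: (alpha e _) => a; have h := hub_large; move: Vk mk kQ k1 h.
move: #|V| #|cut_off _| #|Q| m; clear=> n l q p nk pk kq k1 h h1 h2.
have [p1|/h] := leqP p 1; last by nia.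
by case: p p1 {h} pk h2 => [|[|]] //; nia.
Qed.

Lemma threshold : exists kap, [/\ 1 < kap, kap < k, #|cut_off kap.-1| <= k & k < #|cut_off kap|].
Proof.
have ex : exists j, k < #|cut_off j| by exists k.-1; apply: card_top.
case: (ex_minnP ex) => j kj jmin; exists j; have mk := card_M; have k1 := k_gt1.
have j2 : 1 < j.
  rewrite ltnNge; apply/negP => j1; have := subset_leq_card (cut_off_mono j1).
  by rewrite leqNgt (ltn_trans mk kj).
split => //.
  by have := jmin _ card_top; move: k1; clear; lia.
rewrite leqNgt; apply/negP => /jmin; move: j2; clear; lia.
Qed.

(** Take [Y] of maximal size. A boundary vertex in [M] could be absorbed together with a side of its
    own, and by [bdU] the boundary would not grow. *)
Lemma max_cut s v : v \in cut_off s -> exists Y,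
  [/\ v \in Y, [disjoint Y & Q], #|bd e Y| <= s & [disjoint bd e Y & M]].
Proof.
case/cut_offP=> Y0 [v0 d0 b0].
pose ok (Y : {set V}) := [&& v \in Y, [disjoint Y & Q] & #|bd e Y| <= s].
have ok0 : ok Y0 by rewrite /ok v0 d0.
case: (arg_maxnP (fun Y : {set V} => #|Y|) ok0) => Y /and3P[vY dY bY] Ymax.
exists Y; split => //; apply/pred0P => u /=; apply/negP => /andP[ub /cut_offP[Z [uZ dZ bZ]]].
have uY : u \notin Y by move: ub; rewrite inE => /andP[].
have : #|Y :|: Z| <= #|Y|.
  apply: Ymax; rewrite /ok in_setU vY disjointU //=.
  by have := bdU ub uZ; move: bY bZ; arith.
rewrite leqNgt => /negP; apply; apply: proper_card; apply/properP; split.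
  exact: subsetUl.
by exists u; rewrite // in_setU uZ orbT.
Qed.

(** A coarse bound on the separators: between 1 and [kap - 1] levels are not told apart. *)
Definition level kap v := if v \in M then 1 else if v \in cut_off kap.-1 then kap.-1 else kap.

Lemma cuts kap : exists Y : V -> {set V}, {in cut_off kap, forall v,
  [/\ v \in Y v, [disjoint Y v & Q], #|bd e (Y v)| <= level kap v &
      v \notin M -> [disjoint bd e (Y v) & M]]}.
Proof.
have h v : exists Y : {set V}, v \in cut_off kap ->
    [/\ v \in Y, [disjoint Y & Q], #|bd e Y| <= level kap v &
      v \notin M -> [disjoint bd e Y & M]].
  have [vL|] := boolP (v \in cut_off kap); last by exists set0.
  have [vM|vM] := boolP (v \in M).
    by have /cut_offP[Y [vY dY bY]] := vM; exists Y; rewrite /level vM.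
  have /max_cut[Y [vY dY bY bM]] : v \in cut_off (level kap v).
    by rewrite /level (negbTE vM); case: ifP.
  by exists Y.
by have [Y YP] := fin_all_exists h; exists Y.
Qed.

(** An exchange: inner vertices have no [e]-neighbour in [M], so a stable subset of [T] can replace
    [Q' :\: M] in the maximum stable set [Q']. *)
Lemma alpha_inner Q' T : stable e Q' -> #|Q'| = alpha e setT -> T \subset ~: M :\: outer ->
  alpha e T <= #|Q' :\: M|.
Proof.
move=> sQ Q'a TW; have [I sI [IT <-]] := alpha_ex e T.
have IW w : w \in I -> w \notin M /\ w \notin outer.
  by move/(subsetP IT)/(subsetP TW); rewrite in_setD in_setC => /andP[].
have sU : stable e (I :|: (Q' :&: M)).
  apply: stableU => //; first by apply: stableS sQ; apply: subsetIl.
  move=> w y wI /setIP[_ yM]; have [wM wo] := IW w wI.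
  have yw : y != w by apply: contraNneq wM => <-.
  rewrite e_sym -co //; apply: inner_co => //; by rewrite in_setD in_setC wo.
have := alpha_ge sU (subsetT _); rewrite -Q'a -(cardsID M Q').
have dI : [disjoint I & Q' :&: M].
  by apply/pred0P => w /=; apply/negP => /andP[/IW[wM _] /setIP[_]]; apply/negP.
have -> : #|I :|: Q' :&: M| = #|I| + #|Q' :&: M| by rewrite cardsU (disjoint_setI0 dI) cards0 subn0.
by rewrite addnC leq_add2l.
Qed.

(* The side [~: (Z :|: R)] of the cut is small, which forces [M \subset R].  Then
   [Q'] has few vertices outside [M], against [gap_bound] unless [#|M| = k.-1],
   when one cycle in addition to [covers_outer] covers everything. *)
Lemma bad_cut kap S Z (R Q' : {set V}) : 1 < kap < k -> #|cut_off kap.-1| <= k ->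
    #|S| <= kap -> [disjoint S & M] -> #|R| < k -> [disjoint Z & R] ->
    {in ~: (Z :|: R) & Z, forall w z, e w z} -> ~: (Z :|: R) \subset S ->
    stable e Q' -> #|Q'| = alpha e setT -> k < #|Q'| -> [disjoint Z & Q'] ->
  False.
Proof.
case/andP=> kap1 kapk Lk Sk dSM Rk dZR ZW; set W := ~: (Z :|: R) => WS sQ Qa' kQ' dZQ.
have mk := card_M; have k1 := k_gt1.
have WE w : (w \in W) = (w \notin Z) && (w \notin R) by rewrite in_setC in_setU negb_or.
have Wk : #|W| <= kap by apply: leq_trans (subset_leq_card WS) Sk.
have QWR : Q' \subset W :|: R.
  by apply/subsetP => v vQ; rewrite in_setU WE (disjointFl dZQ vQ) /= orNb.
have W2 : 1 < #|W|.
  have := leq_trans (subset_leq_card QWR) (leq_card_setU W R).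
  by move: kQ' Rk; arith.
have MW u : u \in M -> u \notin W.
  by move=> uM; apply/negP => /(subsetP WS) uS; rewrite (disjointFr dSM uS) in uM.
have MR : M \subset R.
  apply/subsetP => u uM; have := MW u uM; rewrite WE -negb_or negbK => /orP[uZ|//].
  have /card_gt1P[w [w' [wW wW' ww]]] := W2.
  case/negP: ww; apply/eqP; apply: (outer_uniq uM).
  - by apply: contraL wW; apply: MW.
  - by apply: contraL wW'; apply: MW.
  - by rewrite e_sym ZW.
  - by rewrite e_sym ZW.
have QM : #|Q' :\: M| + m <= #|W| + #|R|.
  rewrite -(cardsID M R) (setIidPr MR) -/m addnCA addnC leq_add2l.
  apply: leq_trans (leq_card_setU W (R :\: M)); apply/subset_leq_card/subsetP => v.
  by rewrite in_setD in_setU in_setD => /andP[-> /(subsetP QWR)]; rewrite in_setU.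
have kap0 : 0 < kap.-1 by rewrite -ltnS prednK // ltnW.
have gap := gap_bound (introT andP (conj kap1 (ltnW kapk))) Lk.
have aT : alpha e (~: cut_off kap.-1 :\: outer) <= #|Q' :\: M|.
  by apply: alpha_inner => //; apply: setSD; rewrite setCS M_sub_cut_off.
have L2 : kap = 2 -> #|cut_off kap.-1| = m by move=> ->.
(* With [k - m = d + 1], the bounds [gap], [QM], [#|R| < k] and [Lk] combine to [d * kap <= d * 2].
   For [kap = 2] the set in [Lk] is [M] itself and they clash; so [kap > 2] and [d = 0]. *)
have [m_k kap3] : m.+1 = k /\ 2 < kap.
  move: mk k1 kap1 kapk Wk Rk QM aT gap L2 Lk.
  move: #|R| #|W| #|_ :\: M| (alpha e _) #|cut_off _| m; clear => r w q a l p.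
  move=> pk k1 kap1 kapk wk rk qp aq gap L2 lk.
  have [d E] : exists d, k = p + d.+1 by exists (k - p).-1; lia.
  rewrite {}E addKn in pk k1 kapk rk gap lk *.
  have [kap2|kap2] := leqP kap 2.
    by have kapE : kap = 2 by [lia]; have := L2 kapE; rewrite kapE in gap wk; nia.
  have h : d * kap <= d * 2 by move: gap; rewrite mulSn; lia.
  have h3 : d * 3 <= d * kap by rewrite leq_mul2l kap2 orbT.
  by split=> //; have := leq_trans h3 h; clear; lia.
have RM : R = M.
  by apply/esym/eqP; rewrite eqEcard MR -/m -ltnS m_k.
have m1 : 1 < m by move: m_k kap3 kapk; clear; lia.
have hub := hub_large m1; have oc := outer_card.
pose Zo := Z :\: outer.
have ZoM : Zo \subset ~: M :\: outer.
  by apply: setSD; rewrite -disjoints_subset -RM.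
have QZ : #|Q| <= #|W| + (#|Zo| + #|outer|).
  apply: leq_trans (leq_trans _ (leq_card_setU W (Zo :|: outer))) _; last first.
    by rewrite leq_add2l leq_card_setU.
  apply/subset_leq_card/subsetP => v vQ.
  rewrite !in_setU in_setD WE RM (disjointFl (cut_off_disjoint 1) vQ).
  by case: (v \in Z); case: (v \in outer).
(* [#|Q|] exceeds [m * m], while [W] and [outer] have at most [m] vertices each, and [m >= 3]. *)
have ZW_card : #|W| <= #|Zo|.
  move: QZ hub oc m_k kap3 kapk Wk; rewrite -/m; move: #|W| #|Zo| #|outer| #|Q| m; clear.
  by move=> w z o q p; nia.
have cW : covers e 1 (Zo :|: W).
  apply: covers_bipartite_alpha => //.
  - by rewrite -card_gt0; move: ZW_card W2; arith.
  - by rewrite -card_gt0; move: W2; arith.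
  - apply/pred0P => v /=; rewrite in_setD WE; apply/negP => /and3P[/andP[_ vZ]].
    by rewrite vZ.
  - by move=> z w /setDP[zZ _] wW; rewrite e_sym ZW.
  - rewrite mul1n; apply: leq_trans (alpha_inner sQ Qa' ZoM) _.
    apply/subset_leq_card/subsetP => v /setDP[/(subsetP QWR)]; rewrite in_setU RM.
    by case/orP=> // ->.
  - by rewrite mul1n; apply: leq_trans (alpha_card _ _) ZW_card.
apply: nc; apply: coversS (coversU covers_outer cW); first by rewrite addn1 m_k.
apply/subsetP => v _; rewrite !in_setU in_setD WE RM.
by case: (v \in M); case: (v \in outer); case: (v \in Z).
Qed.

Lemma subset_between (C D : {set V}) n : C \subset D -> #|C| <= n <= #|D| ->
  exists A : {set V}, [/\ C \subset A, A \subset D & #|A| = n].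
Proof.
move=> CD /andP[]; elim: n => [|n IH] h1 h2.
  by exists C; split => //; apply/eqP; rewrite -leqn0.
move: h1; rewrite leq_eqVlt => /predU1P[h1|h1]; first by exists C.
have [A [CA AD An]] := IH h1 (ltnW h2).
have /subsetPn[x xD xA] : ~~ (D \subset A).
  by apply: contraL h2 => /subset_leq_card; rewrite An -ltnNge ltnS.
exists (x |: A); split; first exact: subset_trans (subsetUr _ _).
  by rewrite subUset sub1set xD.
by rewrite cardsU1 xA An.
Qed.

Lemma sum_bound (A : {set V}) (f : V -> nat) c : {in A, forall v, f v <= c} ->
  \sum_(v in A) f v <= #|A| * c.
Proof. by move=> h; rewrite -sum_nat_const; apply: leq_sum. Qed.

Lemma level_arith n p l a j s1 s2 s3 : s1 <= p * 1 -> s2 <= (l - p) * j.-1 ->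
    s3 <= (n.+1 - l) * j -> (n - p) * j + p < a + l -> l <= n -> p <= l -> 0 < j.-1 ->
  s1 + s2 + s3 < a + j + p.
Proof.
move=> b1 b2 b3 gap ln pl j0.
have [u E] : exists u, l = p + u by exists (l - p); rewrite subnKC.
have [v Ev] : exists v, n = l + v by exists (n - l); rewrite subnKC.
have [i Ej] : exists i, j = i.+1 by exists j.-1; rewrite prednK // (leq_trans j0) // leq_pred.
move: b1 b2 b3 gap; rewrite Ev -addnS addKn E -addnA !addKn Ej /= muln1 !mulnS mulSn.
by rewrite mulnDl; lia.
Qed.

(** With [l = #|cut_off kap.-1|] the three levels contribute at most
    [(k - m) * kap + m + kap + m - l], and [gap_bound] replaces the first two terms by less than the
    stability number plus [l]. *)
Lemma level_sum kap (A : {set V}) : 1 < kap <= k -> #|cut_off kap.-1| <= k ->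
    cut_off kap.-1 \subset A -> #|A| = k.+1 ->
  \sum_(v in A) level kap v < alpha e (~: cut_off kap.-1 :\: outer) + kap + m.
Proof.
move=> kapk Lk LA Ak; have gap := gap_bound kapk Lk.
have kap0 : 0 < kap.-1 by case/andP: kapk => kap1 _; rewrite -ltnS prednK // ltnW.
have ML := M_sub_cut_off kap0.
have b1 : \sum_(v in M) level kap v <= m * 1.
  by apply: sum_bound => v vM; rewrite /level vM.
have b2 : \sum_(v in cut_off kap.-1 :\: M) level kap v <= (#|cut_off kap.-1| - m) * kap.-1.
  have -> : #|cut_off kap.-1| - m = #|cut_off kap.-1 :\: M| by rewrite cardsD (setIidPr ML).
  apply: sum_bound => v /setDP[vL vM].
  by rewrite /level (negbTE vM) vL.
have b3 : \sum_(v in A :\: cut_off kap.-1) level kap v <= (k.+1 - #|cut_off kap.-1|) * kap.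
  have -> : k.+1 - #|cut_off kap.-1| = #|A :\: cut_off kap.-1| by rewrite cardsD (setIidPr LA) Ak.
  apply: sum_bound => v /setDP[_ vL].
  by rewrite /level (negbTE vL) (contraNF (subsetP ML v) vL).
rewrite (big_setID (cut_off kap.-1)) (setIidPr LA) (big_setID M) (setIidPr ML) /=.
exact: level_arith b1 b2 b3 gap Lk (subset_leq_card ML) kap0.
Qed.

Lemma cut_system : exists kap a (A : {set V}) (Y : V -> {set V}),
  [/\ 1 < kap < k, #|cut_off kap.-1| <= k, #|A| = k.+1 & M \subset A] /\
  [/\ a + m + #|Q| <= #|V|.+1, a <= alpha e setT,
      \sum_(v in A) #|bd e (Y v)| < a + kap + m &
      {in A, forall v, [/\ v \in Y v, [disjoint Y v & Q], #|bd e (Y v)| <= kap,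
        v \in M -> #|bd e (Y v)| <= 1 & v \notin M -> [disjoint bd e (Y v) & M]]}].
Proof.
have [kap [kap1 kapk Lk kL]] := threshold; have [Y YP] := cuts kap.
have LL : cut_off kap.-1 \subset cut_off kap by apply/cut_off_mono/leq_pred.
have [|A [LA AL Ak]] := subset_between (n := k.+1) LL; first by rewrite (leq_trans Lk).
have kap0 : 0 < kap.-1 by rewrite -ltnS prednK // ltnW.
have ML := M_sub_cut_off kap0.
exists kap, (alpha e (~: cut_off kap.-1 :\: outer)), A, Y; split.
  by split; rewrite ?kap1 //; apply: subset_trans LA.
split.
- apply: alpha_card_hub; last exact: cut_off_disjoint.
  by rewrite disjoints_subset; apply: subset_trans (subsetDl _ _) _; rewrite setCS.
- exact/alphaS/subsetT.
- apply: leq_ltn_trans (level_sum _ Lk LA Ak); last by rewrite kap1 ltnW.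
  by apply: leq_sum => v /(subsetP AL) /YP[].
move=> v vA; have [vY dY bY dM] := YP v (subsetP AL v vA); split => //.
  by apply: leq_trans bY _; rewrite /level; do 2?case: ifP => _ //; rewrite ?leq_pred ?(ltnW kap1).
by move=> vM; move: bY; rewrite /level vM.
Qed.

(* The two sides of the first cut are complete in one colour and those of the
   second cut in the other, so diagonally opposite quadrants of the crossing
   cannot both be inhabited. *)
Lemma cross_cuts Y Z y z : y \in Y -> z \in Z -> z \notin bd e Y -> y \notin bd e' Z ->
    {in ~: (Z :|: bd e' Z) & Z, forall x y, e x y} ->
  ~: (Y :|: bd e Y) \subset bd e' Z \/ ~: (Z :|: bd e' Z) \subset bd e Y.
Proof.
move=> yY zZ zS yR ZW.
set X := ~: (Y :|: bd e Y); set W := ~: (Z :|: bd e' Z) in ZW *.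
have XE u : (u \in X) = (u \notin Y) && (u \notin bd e Y) by rewrite in_setC in_setU negb_or.
have WE u : (u \in W) = (u \notin Z) && (u \notin bd e' Z) by rewrite in_setC in_setU negb_or.
have no u v : u \in X -> v \in Y -> ~~ e u v.
  move=> uX vY; rewrite -co; first exact: (@bd_co Y).
  by apply: contraTneq uX => ->; rewrite XE vY.
have C1 u v : u \in Y -> u \in Z -> v \in X -> v \in W -> False.
  by move=> uY uZ vX vW; have := no v u vX uY; rewrite ZW.
have C2 u v : u \in Y -> u \in W -> v \in X -> v \in Z -> False.
  by move=> uY uW vX vZ; have := no v u vX uY; rewrite e_sym ZW.
have XW u : u \in X -> u \notin W.
  move=> uX; apply/negP => uW; have [yZ|yZ] := boolP (y \in Z); first exact: C1 yZ uX uW.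
  have yW : y \in W by rewrite WE yZ.
  have [zY|zY] := boolP (z \in Y); first exact: C1 zY zZ uX uW.
  by apply: (C2 y z) => //; rewrite XE zY.
have [/exists_inP[x xX xZ]|nX] := boolP [exists x in X, x \in Z]; [right|left].
  apply/subsetP => u uW; have := contraL (XW u) uW; rewrite XE negb_and !negbK.
  by case/orP=> // uY; case: (C2 u x).
apply/subsetP => u uX; have := XW u uX; rewrite WE negb_and !negbK => /orP[uZ|//].
by case/exists_inP: nX; exists u.
Qed.

End Colour.

(** * Crossing the cuts of the two colours *)

Lemma double_count (V : finType) (A B : {set V}) (f g : V -> {set V}) :
    {in A & B, forall y z, (z \in f y) || (y \in g z)} ->
  #|A| * #|B| <= \sum_(y in A) #|f y| + \sum_(z in B) #|g z|.
Proof.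
move=> h; have card_le (C D : {set V}) : \sum_(z in C) (z \in D) <= #|D|.
  rewrite -sum1_card big_mkcond [leqRHS]big_mkcond; apply: leq_sum => z _.
  by case: (z \in C); case: (z \in D).
apply: leq_trans (_ : \sum_(y in A) \sum_(z in B) ((z \in f y) + (y \in g z)) <= _).
  rewrite -sum_nat_const; apply: leq_sum => y yA; rewrite -sum1_card; apply: leq_sum => z zB.
  by have := h y z yA zB; case: (z \in f y); case: (y \in g z).
under eq_bigr do rewrite big_split.
rewrite big_split leq_add //=; last rewrite exchange_big /=.
  by apply: leq_sum => y _; apply: card_le.
by apply: leq_sum => z _; apply: card_le.
Qed.

Lemma bd_disjoint (V : finType) (e : rel V) (Y : {set V}) : [disjoint Y & bd e Y].
Proof. by apply/pred0P => v /=; rewrite inE; case: (v \in Y). Qed.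

Lemma covers_other_colour (V : finType) (e e' : rel V) k :
    symmetric e -> irreflexive e -> symmetric e' -> irreflexive e' ->
    (forall x y, x != y -> e' x y = ~~ e x y) -> #|V| <= k * k ->
  ~ covers e k setT -> covers e' k setT.
Proof.
move=> es ei e's e'i co Vk nc; apply: NNPP => nc'.
have co' x y : x != y -> e x y = ~~ e' x y by move/co ->; rewrite negbK.
have [Q sQ [_ Qa]] := alpha_ex e' setT; have cQ := stable_clique co sQ.
have [Q' sQ' [_ Qa']] := alpha_ex e setT; have cQ' := stable_clique co' sQ'.
have kQ := k_lt_hub e's e'i nc' Qa; have kQ' := k_lt_hub es ei nc Qa'.
have [kap [a [A [Y [[kapk Lk Ak MA] [aQ a_le sA YP]]]]]] :=
  cut_system es ei e's e'i co Vk nc' cQ Qa nc.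
have [kap' [a' [B [Z [[kapk' Lk' Bk MB] [aQ' a_le' sB ZP]]]]]] :=
  cut_system e's e'i es ei co' Vk nc cQ' Qa' nc'.
set M := cut_off e Q 1 in MA aQ sA YP; set M' := cut_off e' Q' 1 in MB aQ' sB ZP.
case/andP: (kapk) => kap1 kap_k; case/andP: (kapk') => kap1' kap_k'.
(* A pair without incidence confines one side of a cut to the other separator by [cross_cuts].
   [bad_cut] refutes this once [y] and [z] are known to lie outside [M] and [M'], where the
   separators avoid these sets. *)
have cross : {in A & B, forall y z, (z \in bd e (Y y)) || (y \in bd e' (Z z))}.
  move=> y z yA zB; apply/negPn/negP; rewrite negb_or => /andP[zS yR].
  have [yY dYQ bY Y1 YM] := YP y yA; have [zZ dZQ bZ Z1 ZM] := ZP z zB.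
  have ZW := @bd_co _ _ _ e's co' (Z z); have YX := @bd_co _ _ _ es co (Y y).
  have QX : Q \subset ~: (Y y :|: bd e (Y y)) :|: bd e (Y y).
    by apply/subsetP => v vQ; rewrite in_setU in_setC in_setU (disjointFl dYQ vQ) /= orNb.
  have QW : Q' \subset ~: (Z z :|: bd e' (Z z)) :|: bd e' (Z z).
    by apply/subsetP => v vQ; rewrite in_setU in_setC in_setU (disjointFl dZQ vQ) /= orNb.
  have big (P S R : {set V}) : P \subset S :|: R -> #|P| <= #|S| + #|R|.
    by move=> /subset_leq_card h; apply: leq_trans h (leq_card_setU _ _).
  case: (cross_cuts es co yY zZ zS yR ZW) => [XR|WS].
    have Qb : #|Q| <= #|bd e' (Z z)| + #|bd e (Y y)|.
      by apply: big; apply: subset_trans QX _; apply: setSU.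
    (* For [y] in [M] the separator has at most one vertex, and the hub would have at most
       [kap' + 1 <= k] vertices. *)
    have yM : y \notin M.
      by apply/negP => /Y1; move: Qb kQ bZ kap_k'; clear; lia.
    have zM : z \notin M'.
      by apply/negP => /Z1; move: Qb kQ bY kap_k; clear; lia.
    apply: (bad_cut e's e'i es ei co' Vk nc cQ' Qa' nc' kapk' Lk' bZ (ZM zM) _ _
      YX XR sQ Qa kQ dYQ).
    - exact: leq_ltn_trans kap_k.
    - exact: bd_disjoint.
  have Qb : #|Q'| <= #|bd e (Y y)| + #|bd e' (Z z)|.
    by apply: big; apply: subset_trans QW _; apply: setSU.
  have yM : y \notin M.
    by apply/negP => /Y1; move: Qb kQ' bZ kap_k'; clear; lia.
  have zM : z \notin M'.
    by apply/negP => /Z1; move: Qb kQ' bY kap_k; clear; lia.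
  apply: (bad_cut es ei e's e'i co Vk nc' cQ Qa nc kapk Lk bY (YM yM) _ _ ZW WS sQ' Qa' kQ' dZQ).
  - exact: leq_ltn_trans kap_k'.
  - exact: bd_disjoint.
have total := double_count cross.
have small (C D : {set V}) (f : V -> {set V}) : D \subset C ->
    {in C, forall v, v \in D -> #|f v| <= 1} ->
    \sum_(v in D) #|f v| <= #|D|.
  move=> DC h; rewrite -sum1_card; apply: leq_sum => v vD; apply: h => //.
  exact: (subsetP DC).
have sM : \sum_(v in M) #|bd e (Y v)| <= #|M|.
  by apply: small MA _ => v vA; case: (YP v vA).
have sM' : \sum_(v in M') #|bd e' (Z v)| <= #|M'|.
  by apply: small MB _ => v vB; case: (ZP v vB).
(* The same count restricted to [M] and [M'], whose separators have at most one vertex. *)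
have mm : #|M| * #|M'| <= #|M| + #|M'|.
  apply: leq_trans (leq_add sM sM'); apply: double_count => y z yM zM'.
  by apply: cross; [apply: (subsetP MA) | apply: (subsetP MB)].
move: mm total; rewrite Ak Bk => mm total.
have {total} := leq_trans total (leqnn _); move: sA sB aQ aQ' a_le a_le'; rewrite -Qa -Qa'.
move: Vk kap_k kap_k' mm; clear.
move: #|V| #|M| #|M'| #|Q| #|Q'| (\sum_(v in A) _) (\sum_(v in B) _).
move=> n m m' q q' s s' nk kk kk' mm ss ss' b b' aa aa' total.
(* [a <= #|Q'|] and [a' + #|M'| + #|Q'| <= #|V| + 1] eliminate the stability numbers. The slack 4
   comes from the two strict bounds on the sums and from [kap < k] and [kap' < k]. With [h'] both
   sets have at least 4 vertices, too many for [mm]. *)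
have h : k * k + 4 <= n + m by rewrite mulSn mulnS in total; lia.
have h' : k * k + 4 <= n + m' by rewrite mulSn mulnS in total; lia.
have m4 : 4 <= m by lia.
have : 4 * m' <= m * m' by rewrite leq_mul2r orbC; lia.
have : m * 4 <= m * m' by rewrite leq_mul2l; lia.
lia.
Qed.

(** * From two complementary graphs to edge colourings *)

Import Order.TTheory GRing.Theory Num.Theory.

Lemma mcyc_monochromatic (V : finType) (c : rel V) b s :
  mcyc [rel x y | (x != y) && (c x y == b)] s -> monochromatic_cycle c b s.
Proof.
case/and3P; case: s => [//|x [//|y [|z s]]] _ us cs.
  by move: cs; rewrite /= => /and3P[].
rewrite /monochromatic_cycle /ucycleb us andbT; move: cs; rewrite orFb.
by apply: sub_path => u v /= /andP[].
Qed.

Lemma ceil_sqrt (R : realType) (n : nat) : exists k : nat,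
  (Posz k = Num.ceil (Num.sqrt (n%:R : R)))%R /\ n <= k * k.
Proof.
pose r := Num.sqrt (n%:R : R)%R.
have r0 : (0 <= r)%R by apply: sqrtr_ge0.
have c0 : (0 <= Num.ceil r)%R by rewrite -(ceil0 R) le_ceil.
exists `|Num.ceil r|%N; rewrite gez0_abs //; split => //.
have rk : (r <= `|Num.ceil r|%N%:R)%R.
  by rewrite pmulrn gez0_abs // ceil_ge.
rewrite -(ler_nat R) natrM -expr2 -(sqr_sqrtr (ler0n R n)).
by rewrite ler_sqr // nnegrE (le_trans r0).
Qed.

Theorem theorem1p2 (R : realType) (n : nat) (hn : (0 < n)%N)
    (c : rel 'I_n) (c_sym : symmetric c) :
  exists (b : bool) (C : seq (seq 'I_n)),
    [/\ (Posz (size C) <= Num.ceil (Num.sqrt (n%:R : R)))%R,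
        forall s, s \in C -> monochromatic_cycle c b s
      & forall v : 'I_n, exists2 s, s \in C & v \in s].
Proof.
have [k [<- nk]] := ceil_sqrt R n.
(* Clearing the diagonal makes both colours irreflexive; off the diagonal they remain
   complementary. *)
pose e b := [rel x y : 'I_n | (x != y) && (c x y == b)].
have es b : symmetric (e b) by move=> x y; rewrite /= eq_sym c_sym.
have ei b : irreflexive (e b) by move=> x; rewrite /= eqxx.
have co x y : x != y -> e false x y = ~~ e true x y.
  by move=> xy; rewrite /= xy; case: (c x y).
have nk' : #|'I_n| <= k * k by rewrite card_ord.
have done b : covers (e b) k setT -> exists (b : bool) (C : seq (seq 'I_n)),
    [/\ (Posz (size C) <= Posz k)%R, forall s, s \in C -> monochromatic_cycle c b s
      & forall v : 'I_n, exists2 s, s \in C & v \in s].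
  case=> cs [mc sc fc]; exists b, cs; split => //.
  - by move=> s /(allP mc); apply: mcyc_monochromatic.
  - by move=> v; apply/flattenP/fc; rewrite in_setT.
have [h|h] := classic (covers (e true) k setT); first exact: done h.
apply: (done false).
exact: covers_other_colour (es true) (ei true) (es false) (ei false) co nk' h.
Qed.
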